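(* Maximal SSG restricted to DAGs admits a polynomial-time approximation scheme: for every fixed integer $k\ge 1$ there is a polynomial-time algorithm that, given a DAG $G=(V,A)$, nonnegative weights $w$ and a bound $B>0$, outputs a feasible solution $S$ of Maximal SSG with $w(S)\le \frac{k+1}{k}\,\mathrm{OPT}$, where $\mathrm{OPT}$ is the optimal value of Maximal SSG on this instance.
   Context: A DAG is a digraph with no directed circuit. $w(S)=\sum_{v\in S}w(v)$. A set $S\subseteq V$ satisfies the digraph constraints if for every $x\in S$ and every arc $(x,y)\in A$, $y\in S$. Maximal SSG: given a digraph $G=(V,A)$, nonnegative weights $w$ and a bound $B>0$, a feasible solution is a set $S\subseteq V$ satisfying the digraph constraints and $w(S)\le B$ such that no $S'\supsetneq S$ satisfies both the digraph constraints and $w(S')\le B$; the goal is to minimize $w(S)$. *)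

(* Defs.v *)
From Stdlib Require Import BinNums.
From mathcomp Require Import all_boot all_order all_algebra.

Set Implicit Arguments.
Unset Strict Implicit.
Unset Printing Implicit Defensive.

Import Order.TTheory GRing.Theory Num.Theory.

(** * Maximal SSG *)

(* A digraph on the finite vertex set V is its arc relation. A directed circuit
   is a nonempty closed walk without repeated vertices (loops included). *)
Definition dag (V : finType) (A : rel V) : Prop :=
  forall c : seq V, c != [::] -> ~ ucycle A c.

Section MaximalSSG.
Local Open Scope ring_scope.
Variables (V : finType) (A : rel V) (w : V -> rat) (B : rat).
Implicit Types S T : {set V}.

Definition weight S : rat := \sum_(v in S) w v.

Definition digraph_constraints S : Prop :=
  forall x y, x \in S -> A x y -> y \in S.

Definition ssg_set S : Prop := digraph_constraints S /\ weight S <= B.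

Definition feasible S : Prop :=
  ssg_set S /\ forall T, S \proper T -> ~ ssg_set T.

Definition optimal_value (opt : rat) : Prop :=
  (exists2 S, feasible S & weight S = opt) /\
  (forall S, feasible S -> opt <= weight S).

End MaximalSSG.

(** * Model of computation *)

(* The WHILE language over binary trees, with its unit-cost timed semantics
   (N. D. Jones, "Computability and Complexity from a Programming Perspective",
   MIT Press 1997). Every elementary operation manipulates pointers only, so
   that it takes constant time on a machine with shared tree cells; functions
   with polynomially bounded output that are computable in polynomial time in
   this model are exactly those computable in polynomial time by Turing
   machines. *)

Inductive tree : Type := Nil | Cons of tree & tree.

Fixpoint tree_size (d : tree) : nat :=
  if d is Cons a b then (tree_size a + tree_size b).+1 else 1.

Definition tree_hd (d : tree) : tree := if d is Cons a _ then a else Nil.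
Definition tree_tl (d : tree) : tree := if d is Cons _ b then b else Nil.

Inductive expr : Type :=
  | EVar of nat
  | ENil
  | ECons of expr & expr
  | EHd of expr
  | ETl of expr.

(* Nil is false, every other tree is true. *)
Inductive cmd : Type :=
  | CAssign of nat & expr
  | CSeq of cmd & cmd
  | CIf of expr & cmd & cmd
  | CWhile of expr & cmd.

Definition store := nat -> tree.

Definition update (s : store) (x : nat) (d : tree) : store :=
  fun y => if y == x then d else s y.

Fixpoint eval (s : store) (e : expr) : tree :=
  match e with
  | EVar x => s x
  | ENil => Nil
  | ECons e1 e2 => Cons (eval s e1) (eval s e2)
  | EHd e1 => tree_hd (eval s e1)
  | ETl e1 => tree_tl (eval s e1)
  end.

Fixpoint eval_time (e : expr) : nat :=
  match e with
  | EVar _ | ENil => 1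
  | ECons e1 e2 => (eval_time e1 + eval_time e2).+1
  | EHd e1 | ETl e1 => (eval_time e1).+1
  end.

(* [exec c s t s']: started in the store [s], the command [c] halts after
   exactly [t] time units in the store [s']. *)
Inductive exec : cmd -> store -> nat -> store -> Prop :=
  | ExecAssign x e s :
      exec (CAssign x e) s (eval_time e).+1 (update s x (eval s e))
  | ExecSeq c1 c2 s s1 s2 t1 t2 :
      exec c1 s t1 s1 -> exec c2 s1 t2 s2 -> exec (CSeq c1 c2) s (t1 + t2) s2
  | ExecIfTrue e c1 c2 s t s1 :
      eval s e <> Nil -> exec c1 s t s1 ->
      exec (CIf e c1 c2) s (eval_time e + t).+1 s1
  | ExecIfFalse e c1 c2 s t s1 :
      eval s e = Nil -> exec c2 s t s1 ->
      exec (CIf e c1 c2) s (eval_time e + t).+1 s1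
  | ExecWhileTrue e c s s1 s2 t1 t2 :
      eval s e <> Nil -> exec c s t1 s1 -> exec (CWhile e c) s1 t2 s2 ->
      exec (CWhile e c) s (eval_time e + t1 + t2).+1 s2
  | ExecWhileFalse e c s :
      eval s e = Nil -> exec (CWhile e c) s (eval_time e).+1 s.

(* Input and output are held in variable 0; all other variables start at Nil. *)
Definition init (input : tree) : store := update (fun=> Nil) 0 input.

Definition runs (p : cmd) (input : tree) (t : nat) (output : tree) : Prop :=
  exists2 s, exec p (init input) t s & s 0 = output.

Lemma exec_det c s t s' t' s'' :
  exec c s t s' -> exec c s t' s'' -> t = t' /\ s' = s''.
Proof.
move=> h; elim: h t' s'' => {c s t s'}; intros;
  match goal with H : exec _ _ ?t _ |- _ = ?t /\ _ => inversion H; subst end => //;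
  repeat match goal with
  | IH : (forall t' s'', exec ?c ?s t' s'' -> _), H : exec ?c ?s _ _ |- _ =>
      case: (IH _ _ H) => ? ?; subst; clear IH
  end; by [].
Qed.

(** * Encoding of instances and solutions *)

Definition enc_bool (b : bool) : tree := if b then Cons Nil Nil else Nil.

Definition enc_seq (T : Type) (enc : T -> tree) (s : seq T) : tree :=
  foldr (fun x d => Cons (enc x) d) Nil s.

(* Binary digits, least significant first, without leading zeros. *)
Fixpoint pos_bits (p : positive) : seq bool :=
  match p with
  | xH => [:: true]
  | xO q => false :: pos_bits q
  | xI q => true :: pos_bits q
  end.

Definition nat_bits (n : nat) : seq bool :=
  if bin_of_nat n is Npos p then pos_bits p else [::].

Definition enc_nat (n : nat) : tree := enc_seq enc_bool (nat_bits n).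

(* For nonnegative rationals, as a reduced fraction; no sign is recorded. *)
Definition enc_rat (q : rat) : tree :=
  Cons (enc_nat `|numq q|%N) (enc_nat `|denq q|%N).

(* The bound, the list of weights and the adjacency matrix; vertices are listed
   in the order [enum V]. *)
Definition enc_instance (V : finType) (A : rel V) (w : V -> rat) (B : rat) :
    tree :=
  Cons (enc_rat B)
    (Cons (enc_seq (fun v => enc_rat (w v)) (enum V))
          (enc_seq (fun x => enc_seq (fun y => enc_bool (A x y)) (enum V))
                   (enum V))).

(* The characteristic vector of S. *)
Definition enc_set (V : finType) (S : {set V}) : tree :=
  enc_seq (fun v => enc_bool (v \in S)) (enum V).

(* Main.v *)
From Stdlib Require Import BinNums.
From mathcomp Require Import all_boot all_order all_algebra zify lra.
Require Import Defs.

Set Implicit Arguments.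
Unset Strict Implicit.
Unset Printing Implicit Defensive.

Import Order.TTheory GRing.Theory Num.Theory.

(* In a DAG, a closed set is maximal as soon as no single vertex can be added to
   it. Let [S] be an optimal solution. If [w(S) >= kB/(k+1)], every feasible
   solution is within the factor [(k+1)/k]. Otherwise every vertex that can be
   added to [S] without violating the digraph constraints is heavy, i.e. weighs
   more than [B/(k+1)], and [S] contains at most [k] heavy vertices. Adding
   greedily light vertices and heavy vertices of [S], starting from the empty
   set, then rebuilds exactly [S]: a set where this stops strictly inside [S]
   would leave out a sink of the difference. So it suffices to try all sets [H]
   of at most [k] vertices, to run the greedy procedure on the light vertices
   and [H], to complete the result greedily to a maximal set, and to keep the
   lightest outcome.

   The running time is handled by a calculus of polynomial-time computability
   for families of trees: closure under pairing, projections, tests and loops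
   over lists whose state stays polynomially bounded. *)

(** * Polynomial bounds and polynomial-time families of trees *)

(** The constants [c] and [d] are uniform over the index type. The successor keeps the base
    positive, so that raising the exponent never lowers the bound. *)
Definition pbound (X : Type) (N T : X -> nat) : Prop :=
  exists c d, forall x, T x <= c * (N x).+1 ^ d.

Lemma pbound_le X (N T T' : X -> nat) :
  (forall x, T' x <= T x) -> pbound N T -> pbound N T'.
Proof.
by move=> le [c [d H]]; exists c, d => x; apply: leq_trans (le x) (H x).
Qed.

Lemma pbound_id X (N : X -> nat) : pbound N N.
Proof. by exists 1, 1 => x; rewrite mul1n expn1. Qed.

Lemma pbound_const X (N : X -> nat) n : pbound N (fun=> n).
Proof. by exists n, 0 => x; rewrite expn0 muln1. Qed.

Lemma pbound_add X (N T1 T2 : X -> nat) :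
  pbound N T1 -> pbound N T2 -> pbound N (fun x => T1 x + T2 x).
Proof.
move=> [c1 [d1 H1]] [c2 [d2 H2]]; exists (c1 + c2), (d1 + d2) => x.
rewrite mulnDl; apply: leq_add.
  by apply: leq_trans (H1 x) _; rewrite leq_mul2l leq_pexp2l ?orbT ?leq_addr.
by apply: leq_trans (H2 x) _; rewrite leq_mul2l leq_pexp2l ?orbT ?leq_addl.
Qed.

Lemma pbound_mul X (N T1 T2 : X -> nat) :
  pbound N T1 -> pbound N T2 -> pbound N (fun x => T1 x * T2 x).
Proof.
move=> [c1 [d1 H1]] [c2 [d2 H2]]; exists (c1 * c2), (d1 + d2) => x.
by rewrite expnD mulnACA leq_mul.
Qed.

(** [M x + 1] is at most [(c1 + 1) * (N x + 1) ^ d1], since the power is at least 1; raising this to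
    the power [d2] gives the witnesses. *)
Lemma pbound_trans X (N M T : X -> nat) :
  pbound N M -> pbound M T -> pbound N T.
Proof.
move=> [c1 [d1 H1]] [c2 [d2 H2]]; exists (c2 * c1.+1 ^ d2), (d1 * d2) => x.
apply: leq_trans (H2 x) _; rewrite -mulnA leq_mul2l expnM -expnMn.
have [->|d2_gt0] := posnP d2; first by rewrite !expn0 orbT.
rewrite leq_exp2r // mulSn -addn1 addnC (leq_add _ (H1 x)) ?orbT //.
by rewrite expn_gt0.
Qed.

Lemma pbound_reindex X Y (h : Y -> X) (N T : X -> nat) :
  pbound N T -> pbound (N \o h) (T \o h).
Proof. by move=> [c [d H]]; exists c, d => y; apply: H. Qed.

Definition fsize (X : Type) (f : X -> tree) (x : X) : nat := tree_size (f x).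

Lemma tree_size_gt0 d : 0 < tree_size d.
Proof. by case: d. Qed.

(* The program reads its argument from variable 0, may start with arbitrary
   values in its other variables, and leaves the variables from [m] on alone. *)
Definition computes (X : Type) (f g : X -> tree) (p : cmd) (m : nat)
    (T : X -> nat) : Prop :=
  forall x s, s 0 = f x ->
  exists t s', [/\ exec p s t s', s' 0 = g x,
    forall y, m <= y -> s' y = s y & t <= T x].

(* From [f x], a single program produces [g x], for all [x]. The lemmas below read
   like typing rules with context [f]; a loop extends the context by its state
   and the current list element. The size of [g] is bounded separately because
   sharing lets a WHILE program build exponentially large trees. *)
Definition polytime (X : Type) (f g : X -> tree) : Prop :=
  pbound (fsize f) (fsize g) /\
  exists p m T, pbound (fsize f) T /\ computes f g p m T.

Lemma polytime_size X (f g : X -> tree) :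
  polytime f g -> pbound (fsize f) (fsize g).
Proof. by case. Qed.

Lemma polytime_ext X (f g g' : X -> tree) :
  (forall x, g x = g' x) -> polytime f g -> polytime f g'.
Proof.
move=> e [b [p [m [T [bT H]]]]]; split.
  by apply: pbound_le b => x; rewrite /fsize e.
by exists p, m, T; split=> // x s sx; rewrite -e; apply: H.
Qed.

(** The same program and bounds serve after any change of index. This transfers facts about
    instances to families indexed by loop iterations. *)
Lemma polytime_reindex X Y (h : Y -> X) (f g : X -> tree) :
  polytime f g -> polytime (fun y => f (h y)) (fun y => g (h y)).
Proof.
move=> [b [p [m [T [bT H]]]]]; split; first exact: (pbound_reindex h b).
exists p, m, (T \o h); split; first exact: (pbound_reindex h bT).
by move=> y s; apply: H.
Qed.

Lemma polytime_id X (f : X -> tree) : polytime f f.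
Proof.
split; first exact: pbound_id.
exists (CAssign 0 (EVar 0)), 1, (fun=> 2); split; first exact: pbound_const.
move=> x s sx; eexists _, _; split; [exact: ExecAssign | by [] | | by []].
by move=> [].
Qed.

Lemma polytime_nil X (f : X -> tree) : polytime f (fun=> Nil).
Proof.
split; first exact: pbound_const.
exists (CAssign 0 ENil), 1, (fun=> 2); split; first exact: pbound_const.
move=> x s sx; eexists _, _; split; [exact: ExecAssign | by [] | | by []].
by move=> [].
Qed.

Lemma polytime_comp X (f g h : X -> tree) :
  polytime f g -> polytime g h -> polytime f h.
Proof.
move=> [b [p [m [T [bT H]]]]] [b' [p' [m' [T' [bT' H']]]]]; split.
  exact: pbound_trans b b'.
exists (CSeq p p'), (m + m'), (fun x => T x + T' x); split.
  by apply: pbound_add => //; apply: pbound_trans b bT'.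
move=> x s /H [t [s1 [e1 /H' [t' [s2 [e2 s2x pr2 l2]]] pr1 l1]]].
exists (t + t'), s2; split=> //; first exact: ExecSeq e1 e2.
- by move=> y my; rewrite pr2 ?pr1 //; lia.
- exact: leq_add.
Qed.

Lemma polytime_hd X (f g : X -> tree) :
  polytime f g -> polytime f (fun x => tree_hd (g x)).
Proof.
move=> H; apply: polytime_comp H _; split.
  by apply: pbound_le (pbound_id _) => x; rewrite /fsize;
    case: (g x) => //= *; lia.
exists (CAssign 0 (EHd (EVar 0))), 1, (fun=> 3); split;
  first exact: pbound_const.
move=> x s sx; eexists _, _; split; [exact: ExecAssign | | | by []].
  by rewrite /update /= sx.
by move=> [].
Qed.

Lemma polytime_tl X (f g : X -> tree) :
  polytime f g -> polytime f (fun x => tree_tl (g x)).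
Proof.
move=> H; apply: polytime_comp H _; split.
  by apply: pbound_le (pbound_id _) => x; rewrite /fsize;
    case: (g x) => //= *; lia.
exists (CAssign 0 (ETl (EVar 0))), 1, (fun=> 3); split;
  first exact: pbound_const.
move=> x s sx; eexists _, _; split; [exact: ExecAssign | | | by []].
  by rewrite /update /= sx.
by move=> [].
Qed.

Lemma update_neq s x d y : y != x -> update s x d y = s y.
Proof. by rewrite /update => /negbTE->. Qed.

Lemma update_eq s x d : update s x d x = d.
Proof. by rewrite /update eqxx. Qed.

Lemma polytime_cons X (f g h : X -> tree) :
  polytime f g -> polytime f h -> polytime f (fun x => Cons (g x) (h x)).
Proof.
move=> [b [p [m [T [bT H]]]]] [b' [p' [m' [T' [bT' H']]]]]; split.
  apply: pbound_le (pbound_add (pbound_add b b') (pbound_const _ 1)) => x.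
  by rewrite /fsize /=; lia.
(* Neither program alters [M] or [M.+1], and the successor keeps [M] away from 0. [M] saves the
   input while [p] runs, [M.+1] saves the first result while [p'] runs. *)
set M := (m + m').+1.
exists (CSeq (CAssign M (EVar 0)) (CSeq p (CSeq (CAssign M.+1 (EVar 0))
         (CSeq (CAssign 0 (EVar M)) (CSeq p'
         (CAssign 0 (ECons (EVar M.+1) (EVar 0)))))))), M.+2,
       (fun x => T x + T' x + 10); split.
  by do !apply: pbound_add => //; apply: pbound_const.
move=> x s sx.
pose s1 := update s M (s 0).
have [|t2 [s2 [e2 s2x pr2 l2]]] := H x s1; first by rewrite /s1 update_neq.
pose s3 := update s2 M.+1 (s2 0).
pose s4 := update s3 0 (s3 M).
have [|t5 [s5 [e5 s5x pr5 l5]]] := H' x s4.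
  rewrite /s4 update_eq /s3 update_neq ?pr2 ?/s1 ?update_eq //; first by lia.
  by rewrite neq_ltn leqnn.
eexists _, _; split.
- apply: ExecSeq; first exact: ExecAssign.
  apply: ExecSeq; first exact: e2.
  apply: ExecSeq; first exact: ExecAssign.
  apply: ExecSeq; first exact: ExecAssign.
  apply: ExecSeq; first exact: e5.
  exact: ExecAssign.
- rewrite update_eq /= s5x pr5; last lia.
  by rewrite /s4 update_neq // /s3 update_eq s2x.
- move=> y My; rewrite update_neq; last lia.
  rewrite pr5; last lia.
  rewrite /s4 update_neq; last lia.
  rewrite /s3 update_neq; last lia.
  rewrite pr2; last lia.
  by rewrite /s1 update_neq //; lia.
- by rewrite /=; lia.
Qed.

Lemma polytime_ifnil X (f c g h : X -> tree) :
  polytime f c -> polytime f g -> polytime f h ->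
  polytime f (fun x => if c x is Nil then h x else g x).
Proof.
move=> Hc Hg Hh.
(* The test is evaluated first and paired with its context; the remaining program unpacks the pair
   and branches. *)
apply: polytime_comp (polytime_cons Hc (polytime_id f)) _.
case: Hg Hh => [b1 [p [m [T [bT H]]]]] [b' [p' [m' [T' [bT' H']]]]].
have bf : pbound (fsize (fun x : X => Cons (c x) (f x))) (fsize f).
  by apply: pbound_le (pbound_id _) => x; rewrite /fsize /=; lia.
split.
  apply: pbound_trans bf _; apply: pbound_le (pbound_add b1 b') => x.
  by rewrite /fsize; case: (c x) => *; lia.
set M := (m + m').+1.
exists (CSeq (CAssign M (EHd (EVar 0))) (CSeq (CAssign 0 (ETl (EVar 0)))
         (CIf (EVar M) p p'))), M.+1,
       (fun x => T x + T' x + 10); split.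
  by apply: pbound_trans bf _; do !apply: pbound_add => //; apply: pbound_const.
move=> x s sx.
pose s1 := update s M (tree_hd (s 0)).
pose s2 := update s1 0 (tree_tl (s1 0)).
have s20 : s2 0 = f x by rewrite /s2 update_eq /s1 update_neq // sx.
have s2M : s2 M = c x by rewrite /s2 update_neq // /s1 update_eq sx.
have pr2 y : M.+1 <= y -> s2 y = s y.
  by move=> My; rewrite /s2 update_neq ?/s1 ?update_neq //; lia.
case: (c x) s2M => [|a1 a2] s2M.
  have [t3 [s3 [e3 s3x pr3 l3]]] := H' x s2 s20.
  eexists _, s3; split.
  - apply: ExecSeq; first exact: ExecAssign.
    apply: ExecSeq; first exact: ExecAssign.
    by apply: ExecIfFalse e3; rewrite /= -/s1 -/s2 s2M.
  - by [].
  - by move=> y My; rewrite pr3 ?pr2 //; lia.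
  - by rewrite /=; lia.
have [t3 [s3 [e3 s3x pr3 l3]]] := H x s2 s20.
eexists _, s3; split.
- apply: ExecSeq; first exact: ExecAssign.
  apply: ExecSeq; first exact: ExecAssign.
  by apply: ExecIfTrue e3; rewrite /= -/s1 -/s2 s2M.
- by [].
- by move=> y My; rewrite pr3 ?pr2 //; lia.
- by rewrite /=; lia.
Qed.

Lemma polytime_if X (f g h : X -> tree) (b : X -> bool) :
  polytime f (fun x => enc_bool (b x)) -> polytime f g -> polytime f h ->
  polytime f (fun x => if b x then g x else h x).
Proof.
move=> Hb Hg Hh; apply: polytime_ext (polytime_ifnil Hb Hg Hh) => x.
by case: (b x).
Qed.

Lemma polytime_const X (f : X -> tree) (d : tree) : polytime f (fun=> d).
Proof.
elim: d => [|a Ha b Hb]; first exact: polytime_nil.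
exact: polytime_cons.
Qed.

Lemma size_enc_seq (T : Type) (e : T -> tree) (l : seq T) :
  tree_size (enc_seq e l) = (\sum_(t <- l) (tree_size (e t)).+1).+1.
Proof.
by elim: l => [|a l IH] /=; rewrite ?big_nil // big_cons IH addnS addSn.
Qed.

Lemma enc_seq_cat_le (T : Type) (e : T -> tree) (l1 : seq T) t (l2 : seq T) :
  tree_size (e t) <= tree_size (enc_seq e (l1 ++ t :: l2)).
Proof. by rewrite size_enc_seq big_cat big_cons /=; lia. Qed.

Lemma size_le_enc_seq (T : Type) (e : T -> tree) (l : seq T) :
  size l <= tree_size (enc_seq e l).
Proof. by elim: l => //= a l IH; lia. Qed.

(** [st x pre suf] is the loop state after reading [pre], with [suf] still to read. The step is
    required for every index type [Y] so that it can be applied to all iterations on all inputs at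
    once, giving one program for the body. [Tst] bounds the state at every stage, because iterating
    a polynomial step may cause exponential growth. *)
Lemma polytime_loop X (f : X -> tree) (T : X -> Type) (e : forall x, T x ->
  tree)
    (l : forall x, seq (T x)) (st : forall x, seq (T x) -> seq (T x) -> tree)
    (Tst : X -> nat) :
  polytime f (fun x => enc_seq (@e x) (l x)) ->
  polytime f (fun x => st x [::] (l x)) ->
  (forall Y (h : Y -> X) (pre suf : forall y, seq (T (h y)))
      (t : forall y, T (h y)),
    (forall y, l (h y) = pre y ++ t y :: suf y) ->
    polytime (fun y => Cons (f (h y)) (Cons (st (h y) (pre y) (t y :: suf y))
      (e _ (t y))))
         (fun y => st (h y) (rcons (pre y) (t y)) (suf y))) ->
  pbound (fsize f) Tst ->
  (forall x pre suf, l x = pre ++ suf -> tree_size (st x pre suf) <= Tst x) ->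
  polytime f (fun x => st x (l x) [::]).
Proof.
move=> Hl H0 Hstep bst le_st.
apply: polytime_comp (polytime_cons (polytime_id f) (polytime_cons H0 Hl)) _.
set f' := (fun x => Cons (f x) _).
have bf : pbound (fsize f') (fsize f).
  by apply: pbound_le (pbound_id _) => x; rewrite /fsize /=; lia.
split.
  apply: pbound_trans bf _; apply: pbound_le bst => x.
  by apply: le_st; rewrite cats0.
(* The index type of all iterations: an input with a split of its list around the current
   element. *)
pose Y := {x : X & {p : seq (T x) * seq (T x) * T x |
                    l x = p.1.1 ++ p.2 :: p.1.2}}.
have [_ [p [m [T' [[c [d bT']] H]]]]] := Hstep Y (@projT1 _ _)
  (fun y => (sval (projT2 y)).1.1) (fun y => (sval (projT2 y)).1.2)
  (fun y => (sval (projT2 y)).2) (fun y => svalP (projT2 y)).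
(* [U] dominates the size of context, state and element together; [K] then bounds the time of one
   iteration, with a margin for the bookkeeping commands. *)
pose U x := fsize f x + Tst x + fsize (fun x => enc_seq (e x) (l x)) x + 3.
have bU : pbound (fsize f') U.
  apply: pbound_trans bf _; apply: pbound_add; last exact: pbound_const.
  apply: pbound_add; last exact: (polytime_size Hl).
  by apply: pbound_add => //; apply: pbound_id.
pose K x := c * (U x).+1 ^ d + 20.
have bK : pbound (fsize f') K.
  apply: pbound_trans bU _; apply: pbound_add; last exact: pbound_const.
  by exists c, d.
(* Variable [M] keeps the context and [M.+1] the unread part of the list; variable 0 carries the
   state between iterations. *)
pose M := m.+1.
pose body := CSeq (CAssign 0 (ECons (EVar M) (ECons (EVar 0) (EHd
  (EVar M.+1)))))
  (CSeq p (CAssign M.+1 (ETl (EVar M.+1)))).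
exists (CSeq (CAssign M (EHd (EVar 0))) (CSeq (CAssign M.+1 (ETl (ETl
  (EVar 0))))
    (CSeq (CAssign 0 (EHd (ETl (EVar 0)))) (CWhile (EVar M.+1) body)))), M.+2.
exists (fun x => fsize (fun x => enc_seq (e x) (l x)) x * K x + 20); split.
  apply: pbound_add; last exact: pbound_const.
  by apply: pbound_mul bK; apply: pbound_trans bf _; apply: (polytime_size Hl).
move=> x s sx.
have loop suf pre s1 : l x = pre ++ suf -> s1 0 = st x pre suf -> s1 M = f x ->
  s1 M.+1 = enc_seq (e x) suf -> exists t s', [/\
    exec (CWhile (EVar M.+1) body) s1 t s', s' 0 = st x (l x) [::],
    forall y, M.+2 <= y -> s' y = s1 y & t <= size suf * K x + 2].
  elim: suf pre s1 => [|a suf IH] pre s1 lx s10 s1M s1M1.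
    exists 2, s1; split=> //; first exact: ExecWhileFalse.
    by rewrite lx cats0.
  pose s2 := update s1 0 (Cons (f x) (Cons (st x pre (a :: suf)) (e x a))).
  pose y : Y := existT _ x (exist _ (pre, suf, a) lx).
  have [|t3 [s3 [e3 s3x pr3 l3]]] := H y s2; first by rewrite /s2 update_eq.
  have {}l3 : t3 + 20 <= K x.
    rewrite leq_add2r; apply: leq_trans l3 (leq_trans (bT' y) _).
    rewrite leq_mul2l; apply/orP; right.
    have [->|d0] := posnP d; first by rewrite !expn0.
    rewrite leq_exp2r // ltnS /U /fsize /=.
    have := le_st x pre (a :: suf) lx.
    have := @enc_seq_cat_le _ (e x) pre a suf; rewrite -lx.
    by lia.
  pose s4 := update s3 M.+1 (enc_seq (e x) suf).
  have [||||t5 [s5 [e5 s5x pr5 l5]]] := IH (rcons pre a) s4.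
  - by rewrite cat_rcons.
  - by rewrite /s4 update_neq.
  - rewrite /s4 update_neq; last lia.
    by rewrite pr3 ?/s2 ?update_neq //; lia.
  - by rewrite /s4 update_eq.
  have s3M1 : s3 M.+1 = enc_seq (e x) (a :: suf).
    by rewrite pr3 ?/s2 ?update_neq //; lia.
  eexists _, s5; split.
  - apply: ExecWhileTrue; last exact: e5.
      by rewrite /= s1M1.
    apply: ExecSeq; first exact: ExecAssign.
    rewrite /= s1M1 s10 s1M /= -/s2.
    apply: ExecSeq; first exact: e3.
    have -> : s4 = update s3 M.+1 (eval s3 (ETl (EVar M.+1))).
      by rewrite /= s3M1.
    exact: ExecAssign.
  - by [].
  - move=> z Mz; rewrite pr5 // /s4 update_neq; last lia.
    by rewrite pr3 ?/s2 ?update_neq //; lia.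
  - by rewrite /= mulSn; lia.
pose s1 := update s M (tree_hd (s 0)).
pose s2 := update s1 M.+1 (tree_tl (tree_tl (s1 0))).
pose s3 := update s2 0 (tree_hd (tree_tl (s2 0))).
have s10 : s1 0 = f' x by rewrite /s1 update_neq.
have s20 : s2 0 = f' x by rewrite /s2 update_neq.
have [||||t4 [s4 [e4 s4x pr4 l4]]] := loop (l x) [::] s3.
- by [].
- by rewrite /s3 update_eq s20.
- rewrite /s3 update_neq // /s2 update_neq; last lia.
  by rewrite /s1 update_eq sx.
- by rewrite /s3 update_neq // /s2 update_eq s10.
eexists _, s4; split.
- apply: ExecSeq; first exact: ExecAssign.
  apply: ExecSeq; first exact: ExecAssign.
  apply: ExecSeq; first exact: ExecAssign.
  exact: e4.
- by [].
- move=> y My; rewrite pr4 // /s3 update_neq; last lia.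
  by rewrite /s2 update_neq ?/s1 ?update_neq //; lia.
- have := size_le_enc_seq (e x) (l x); rewrite /= /fsize => sl.
  have : size (l x) * K x <= tree_size (enc_seq (e x) (l x)) * K x
    by rewrite leq_mul2r sl orbT.
  by lia.
Qed.

(** * Lists and booleans *)

Lemma polytime_fst X (f g : X -> tree) : polytime (fun x => Cons (f x) (g x)) f.
Proof. exact: (polytime_hd (polytime_id _)). Qed.

Lemma polytime_snd X (f g : X -> tree) : polytime (fun x => Cons (f x) (g x)) g.
Proof. exact: (polytime_tl (polytime_id _)). Qed.

(** The weakening rule: facts about the outer context remain available in a loop body, whose context
    is longer. *)
Lemma polytime_weak X Y (h : Y -> X) (f g : X -> tree) (r : Y -> tree) :
  polytime f g -> polytime (fun y => Cons (f (h y)) (r y)) (fun y => g (h y)).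
Proof.
by move=> H; apply: polytime_comp (polytime_fst _ _) (polytime_reindex h H).
Qed.

Lemma polytime_foldl X (f : X -> tree) (T S : X -> Type)
    (eT : forall x, T x -> tree) (eS : forall x, S x -> tree)
    (l : forall x, seq (T x)) (s0 : forall x, S x)
    (step : forall x, S x -> T x -> S x) (Tst : X -> nat) :
  polytime f (fun x => enc_seq (@eT x) (l x)) ->
  polytime f (fun x => eS x (s0 x)) ->
  (forall Y (h : Y -> X) (s : forall y, S (h y)) (t : forall y, T (h y)),
    polytime (fun y => Cons (f (h y)) (Cons (eS _ (s y)) (eT _ (t y))))
         (fun y => eS _ (step _ (s y) (t y)))) ->
  pbound (fsize f) Tst ->
  (forall x pre suf, l x = pre ++ suf ->
     tree_size (eS x (foldl (@step x) (s0 x) pre)) <= Tst x) ->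
  polytime f (fun x => eS x (foldl (@step x) (s0 x) (l x))).
Proof.
move=> Hl H0 Hs bT leT.
apply: (@polytime_loop X f T eT l
          (fun x pre suf => eS x (foldl (@step x) (s0 x) pre)) Tst) => //.
move=> Y h pre suf t _.
apply: (@polytime_ext _ _ (fun y => eS _ (step _ (foldl (@step _) (s0 (h y))
  (pre y)) (t y)))).
  by move=> y; rewrite foldl_rcons.
exact: Hs.
Qed.

Lemma enc_seq_rev_size (T : Type) (e : T -> tree) (l : seq T) :
  tree_size (enc_seq e (rev l)) = tree_size (enc_seq e l).
Proof.
rewrite !size_enc_seq; congr _.+1.
by elim: l => // a l IH; rewrite rev_cons -cats1 big_cat big_seq1 big_cons IH
  addnC.
Qed.

Lemma enc_seq_cat_size (T : Type) (e : T -> tree) (l1 l2 : seq T) :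
  (tree_size (enc_seq e (l1 ++ l2))).+1 =
  tree_size (enc_seq e l1) + tree_size (enc_seq e l2).
Proof. by rewrite !size_enc_seq big_cat addSn addnS. Qed.

(** Loops push results onto the front of a list, so their outputs come out reversed; this rule puts
    them back in order. *)
Lemma polytime_rev X (f : X -> tree) (T : X -> Type)
    (e : forall x, T x -> tree) (l : forall x, seq (T x)) :
  polytime f (fun x => enc_seq (@e x) (l x)) ->
  polytime f (fun x => enc_seq (@e x) (rev (l x))).
Proof.
move=> Hl.
apply: (@polytime_loop X f T e l (fun x pre suf => enc_seq (@e x) (rev pre))
          (fsize (fun x => enc_seq (@e x) (l x)))) => //.
- exact: polytime_nil.
- move=> Y h pre suf t _.
  apply: (@polytime_ext _ _ (fun y => Cons (e _ (t y)) (enc_seq (@e _) (rev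
    (pre y))))).
    by move=> y; rewrite rev_rcons.
  exact: polytime_comp (polytime_snd _ _)
    (polytime_cons (polytime_snd _ _) (polytime_fst _ _)).
- exact: polytime_size.
- move=> x pre suf; rewrite enc_seq_rev_size /fsize => ->.
  have := enc_seq_cat_size (e x) pre suf;
    have := tree_size_gt0 (enc_seq (e x) suf).
  by lia.
Qed.

Lemma polytime_map X (f : X -> tree) (T : X -> Type)
    (e e' : forall x, T x -> tree) (l : forall x, seq (T x)) :
  polytime f (fun x => enc_seq (@e x) (l x)) ->
  (forall Y (h : Y -> X) (t : forall y, T (h y)),
    polytime (fun y => Cons (f (h y)) (e _ (t y))) (fun y => e' _ (t y))) ->
  polytime f (fun x => enc_seq (@e' x) (l x)).
Proof.
move=> Hl H.
(* Taking all pairs of an input and an element as index type gives one size bound for all images. *)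
have [c [d b]] := polytime_size (H {x : X & T x} (@projT1 _ _) (@projT2 _ _)).
pose L := fsize (fun x => enc_seq (@e x) (l x)).
pose Q x := c * (fsize f x + L x).+2 ^ d.
have sizeE x l' A : tree_size (enc_seq (e x) l') <= A ->
    tree_size (enc_seq (e' x) l') <=
      size l' * (c * (fsize f x + A).+2 ^ d).+1 + 1.
  elim: l' => //= a l' IH lA.
  have {}IH := IH _; rewrite mulSn.
  have : tree_size (e' x a) <= c * (fsize f x + A).+2 ^ d.
    apply: leq_trans (b (existT _ x a)) _; rewrite leq_mul2l; apply/orP; right.
    have [->|d0] := posnP d; first by rewrite !expn0.
    by rewrite leq_exp2r // /fsize /=; lia.
  by have := IH; lia.
suff Hr : polytime f (fun x => enc_seq (@e' x) (rev (l x))).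
  by apply: polytime_ext (polytime_rev Hr) => x; rewrite revK.
apply: (@polytime_loop X f T e l (fun x pre suf => enc_seq (@e' x) (rev pre))
          (fun x => L x * (Q x + 1) + 1)) => //.
- exact: polytime_nil.
- move=> Y h pre suf t _.
  apply: (@polytime_ext _ _ (fun y => Cons (e' _ (t y)) (enc_seq (@e' _) (rev
    (pre y))))).
    by move=> y; rewrite rev_rcons.
  apply: polytime_cons; last first.
    exact: polytime_comp (polytime_snd _ _) (polytime_fst _ _).
  apply: polytime_comp (H Y h t).
  apply: polytime_cons (polytime_fst _ _) _.
  exact: polytime_comp (polytime_snd _ _) (polytime_snd _ _).
- have bL : pbound (fsize f) L by apply: polytime_size Hl.
  apply: pbound_add; last exact: pbound_const.
  apply: (pbound_mul bL); apply: pbound_add; last exact: pbound_const.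
  apply: (@pbound_trans _ _ (fun x => (fsize f x + L x).+1));
    last by exists c, d.
  apply: (@pbound_le _ _ (fun x => fsize f x + L x + 1)); first by move=> x;
    lia.
  apply: pbound_add; last exact: pbound_const.
  by apply: pbound_add => //; apply: pbound_id.
- move=> x pre suf lx; rewrite enc_seq_rev_size.
  have := enc_seq_cat_size (e x) pre suf;
    have := tree_size_gt0 (enc_seq (e x) suf).
  rewrite -lx -/(L x) => sp ee.
  apply: leq_trans (sizeE x pre (L x) _) _; first by rewrite /L /fsize; lia.
  rewrite -/(Q x) leq_add2r addn1 leq_mul2r; apply/orP; right.
  by apply: leq_trans (size_le_enc_seq (e x) pre) _; rewrite /L /fsize; lia.
Qed.

Lemma polytime_zip X (f : X -> tree) (T : X -> Type)
    (e1 e2 : forall x, T x -> tree) (l : forall x, seq (T x)) :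
  polytime f (fun x => enc_seq (@e1 x) (l x)) ->
  polytime f (fun x => enc_seq (@e2 x) (l x)) ->
  polytime f (fun x => enc_seq (fun t => Cons (@e1 x t) (@e2 x t)) (l x)).
Proof.
move=> H1 H2.
pose e x t := Cons (@e1 x t) (@e2 x t).
suff Hr : polytime f (fun x => enc_seq (@e x) (rev (l x))).
  by apply: polytime_ext (polytime_rev Hr) => x; rewrite revK.
pose L x := fsize (fun x => enc_seq (@e1 x) (l x)) x + fsize
  (fun x => enc_seq (@e2 x) (l x)) x.
have sizeE x l' : tree_size (enc_seq (@e x) l') <=
    tree_size (enc_seq (@e1 x) l') + tree_size (enc_seq (@e2 x) l').
  by elim: l' => //= a l' IH; lia.
(* The state pairs the unread part of the second list with the reversed output; when the loop ends,
   the unread part is [Nil]. *)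
apply: (@polytime_ext _ _ (fun x => tree_tl (Cons Nil (enc_seq (@e x) (rev
  (l x)))))) => //.
apply: polytime_tl.
apply: (@polytime_loop X f T e1 l (fun x pre suf =>
   Cons (enc_seq (@e2 x) suf) (enc_seq (@e x) (rev pre)))
          (fun x => L x + L x + 1)) => //.
- exact: polytime_cons H2 (polytime_nil _).
- move=> Y h pre suf t _.
  apply: (@polytime_ext _ _ (fun y => Cons (enc_seq (@e2 _) (suf y)) (Cons
    (e _ (t y)) (enc_seq (@e _) (rev (pre y)))))).
    by move=> y; rewrite rev_rcons.
  apply: polytime_comp (polytime_snd _ _) _.
  set ctx := (fun y : Y => _).
  have Hc : polytime ctx (fun y => Cons (e2 _ (t y)) (enc_seq (@e2 _) (suf y))).
    exact: (polytime_comp (polytime_fst _ _) (polytime_fst _ _)).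
  apply: polytime_cons; first exact: (polytime_tl Hc).
  apply: polytime_cons; last exact: (polytime_comp (polytime_fst _ _)
    (polytime_snd _ _)).
  by apply: polytime_cons; [exact: polytime_snd | exact: (polytime_hd Hc)].
- have bL : pbound (fsize f) L by apply: pbound_add; apply: polytime_size.
  by do !apply: pbound_add => //; apply: pbound_const.
- move=> x pre suf lx /=; rewrite enc_seq_rev_size.
  have := enc_seq_cat_size (e1 x) pre suf;
    have := tree_size_gt0 (enc_seq (e1 x) suf).
  have := enc_seq_cat_size (e2 x) pre suf;
    have := tree_size_gt0 (enc_seq (e2 x) pre).
  have := tree_size_gt0 (enc_seq (e2 x) suf).
  have := sizeE x pre.
  by rewrite -lx /L /fsize; lia.
Qed.

Lemma tree_size_enc_bool b : tree_size (enc_bool b) <= 3.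
Proof. by case: b. Qed.

Lemma polytime_and X (f : X -> tree) (a b : X -> bool) :
  polytime f (fun x => enc_bool (a x)) ->
    polytime f (fun x => enc_bool (b x)) ->
  polytime f (fun x => enc_bool (a x && b x)).
Proof.
move=> Ha Hb.
apply: polytime_ext (polytime_if Ha Hb (polytime_nil f)) => x; by case: (a x).
Qed.

Lemma polytime_or X (f : X -> tree) (a b : X -> bool) :
  polytime f (fun x => enc_bool (a x)) ->
    polytime f (fun x => enc_bool (b x)) ->
  polytime f (fun x => enc_bool (a x || b x)).
Proof.
move=> Ha Hb.
apply: polytime_ext (polytime_if Ha (polytime_const f (enc_bool true)) Hb) => x.
by case: (a x).
Qed.

Lemma polytime_not X (f : X -> tree) (a : X -> bool) :
  polytime f (fun x => enc_bool (a x)) ->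
    polytime f (fun x => enc_bool (~~ a x)).
Proof.
move=> Ha.
apply: polytime_ext (polytime_if Ha (polytime_nil f) (polytime_const f
  (enc_bool true))) => x.
by case: (a x).
Qed.

Lemma polytime_xor X (f : X -> tree) (a b : X -> bool) :
  polytime f (fun x => enc_bool (a x)) ->
    polytime f (fun x => enc_bool (b x)) ->
  polytime f (fun x => enc_bool (a x (+) b x)).
Proof.
move=> Ha Hb.
apply: polytime_ext (polytime_if Ha (polytime_not Hb) Hb) => x.
by case: (a x).
Qed.

Lemma polytime_all X (f : X -> tree) (T : X -> Type)
    (e : forall x, T x -> tree) (l : forall x, seq (T x)) (P :
      forall x, pred (T x)) :
  polytime f (fun x => enc_seq (@e x) (l x)) ->
  (forall Y (h : Y -> X) (t : forall y, T (h y)),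
    polytime (fun y => Cons (f (h y)) (e _ (t y))) (fun y => enc_bool (P _
      (t y)))) ->
  polytime f (fun x => enc_bool (all (@P x) (l x))).
Proof.
move=> Hl H.
have allE (U : Type) (p : pred U) s b : foldl (fun b t => b && p t) b s =
  b && all p s.
  by elim: s b => [|a s IH] b /=; rewrite ?andbT // IH andbA.
apply: (@polytime_ext _ _ (fun x => enc_bool (foldl
  (fun b t => b && P x t) true (l x)))).
  by move=> x; rewrite allE.
apply: (@polytime_foldl X f T (fun=> bool) e (fun=> enc_bool) l (fun=> true)
   (fun x b t => b && P x t) (fun=> 3)) => //.
- exact: polytime_const.
- move=> Y h s t; apply: polytime_and.
    exact: polytime_comp (polytime_snd _ _) (polytime_fst _ _).
  apply: polytime_comp (H Y h t).
  apply: polytime_cons (polytime_fst _ _) _.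
  exact: polytime_comp (polytime_snd _ _) (polytime_snd _ _).
- exact: pbound_const.
- by move=> *; apply: tree_size_enc_bool.
Qed.

(** * Binary arithmetic *)

Definition bval (s : seq bool) : nat :=
  foldr (fun (b : bool) n => b + n.*2) 0 s.

(** Canonical form of a bit list: zeros at the high end, which is the end of the list, are dropped,
    so a [false] survives only in front of a nonempty rest. *)
Definition trim (s : seq bool) : seq bool :=
  foldr (fun b o => if b then b :: o else if o is [::] then [::] else b :: o)
    [::] s.

Lemma nat_bits_cons (b : bool) n :
  nat_bits (b + n.*2) =
  if b then b :: nat_bits n else if nat_bits n is [::] then [::] else b ::
    nat_bits n.
Proof.
rewrite -[n]bin_of_natK {2 3 4}/nat_bits nat_of_binK.
case: (bin_of_nat n) => [|p] /=; first by case: b.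
have -> : b + (nat_of_pos p).*2 = nat_of_bin (Npos (if b then xI p else xO p)).
  by case: b; rewrite /= NatTrec.trecE.
rewrite /nat_bits nat_of_binK; case: b => //=.
by case: p.
Qed.

Lemma nat_bits_bval s : nat_bits (bval s) = trim s.
Proof. by elim: s => //= b s IH; rewrite nat_bits_cons IH. Qed.

Lemma bval_nat_bits n : bval (nat_bits n) = n.
Proof.
rewrite -[RHS]bin_of_natK /nat_bits; case: (bin_of_nat n) => // p.
by elim: p => //= p ->; rewrite NatTrec.trecE.
Qed.

Lemma bval_lt s : bval s < 2 ^ size s.
Proof. by elim: s => //= b s IH; rewrite expnS; case: b; lia. Qed.

Lemma trim_size s n : bval s < 2 ^ n -> size (trim s) <= n.
Proof.
elim: s n => // b s IH n /= lt.
have [n0|n0] := posnP n.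
  have /IH : bval s < 2 ^ 0 by rewrite n0 in lt; case: b lt => /=; lia.
  by case: (trim s) => // _; rewrite n0 in lt *; case: b lt => //=; lia.
have /IH le : bval s < 2 ^ n.-1.
  by move: lt; rewrite -{1}(prednK n0) expnS; case: b => /=; lia.
by case: b lt => _; case: (trim s) le => //= *; lia.
Qed.

Lemma size_enc_bits_le (s : seq bool) : tree_size (enc_seq enc_bool s) <=
  4 * size s + 1.
Proof. by elim: s => //= b s IH; have := tree_size_enc_bool b; lia. Qed.

(** A bit costs at most 3 nodes plus one [Cons]. Together with [lt_size_enc_nat], this reduces size
    bounds for arithmetic to inequalities between numbers. *)
Lemma size_enc_nat_le n b : n < 2 ^ b -> tree_size (enc_nat n) <= 4 * b + 1.
Proof.
move=> lt; apply: leq_trans (size_enc_bits_le _) _.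
rewrite leq_add2r leq_mul2l -[n]bval_nat_bits nat_bits_bval /=.
by apply: trim_size; rewrite bval_nat_bits.
Qed.

Lemma lt_size_enc_nat n : n < 2 ^ tree_size (enc_nat n).
Proof.
rewrite -{1}[n]bval_nat_bits; apply: leq_trans (bval_lt _) _.
by rewrite leq_exp2l // size_le_enc_seq.
Qed.

Definition enc_pair (p : bool * bool) : tree :=
  Cons (enc_bool p.1) (enc_bool p.2).

Lemma size_enc_pairs_le (s : seq (bool * bool)) :
  tree_size (enc_seq enc_pair s) <= 8 * size s + 1.
Proof.
elim: s => //= b s IH; have := tree_size_enc_bool b.1.
by have := tree_size_enc_bool b.2; lia.
Qed.

(* On trees, padding is free: [tree_hd Nil] is the code of [false]. *)
Fixpoint padzip (a b : seq bool) : seq (bool * bool) :=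
  if a is x :: a' then (x, head false b) :: padzip a' (behead b)
  else [seq (false, y) | y <- b].

Lemma bval_padzip1 a b : bval (unzip1 (padzip a b)) = bval a.
Proof. by elim: a b => [|x a IH] b /=; rewrite ?IH //;
  elim: b => //= y b ->. Qed.

Lemma bval_padzip2 a b : bval (unzip2 (padzip a b)) = bval b.
Proof.
elim: a b => [|x a IH] b /=; first by elim: b => //= y b ->.
by rewrite IH; case: b.
Qed.

(** Two passes compute [padzip] in reverse: the first reads [a] while consuming [b], the second
    flushes what remains of [b], padded with [false]. *)
Lemma padzip_foldl a b o :
  let st := foldl (fun (p : seq bool * seq (bool * bool)) t =>
              (behead p.1, (t, head false p.1) :: p.2)) (b, o) a in
  foldl (fun o t => (false, t) :: o) st.2 st.1 = rev (padzip a b) ++ o.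
Proof.
elim: a b o => [|x a IH] b o /=; last by rewrite IH rev_cons cat_rcons.
by elim: b o => //= y b IH o; rewrite IH rev_cons cat_rcons.
Qed.

Lemma polytime_padzip X (f : X -> tree) (a b : X -> seq bool) :
  polytime f (fun x => enc_seq enc_bool (a x)) ->
  polytime f (fun x => enc_seq enc_bool (b x)) ->
  polytime f (fun x => enc_seq enc_pair (padzip (a x) (b x))).
Proof.
move=> Ha Hb.
pose step1 (p : seq bool * seq (bool * bool)) t :=
  (behead p.1, (t, head false p.1) :: p.2).
pose enc1 (p : seq bool * seq (bool * bool)) :=
  Cons (enc_seq enc_bool p.1) (enc_seq enc_pair p.2).
pose st x := foldl step1 (b x, [::]) (a x).
pose La := fsize (fun x => enc_seq enc_bool (a x)).
pose Lb := fsize (fun x => enc_seq enc_bool (b x)).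
have bLa : pbound (fsize f) La by apply: polytime_size.
have bLb : pbound (fsize f) Lb by apply: polytime_size.
have stE l x o : (foldl step1 (b x, o) l).1 = drop (size l) (b x) /\
    size (foldl step1 (b x, o) l).2 = size o + size l.
  elim/last_ind: l => [|l t [IH1 IH2]] /=; first by rewrite drop0 addn0.
  rewrite foldl_rcons /= IH1 size_rcons; split; last by rewrite IH2 addnS.
  by rewrite -drop1 drop_drop add1n.
have drop_le n (s : seq bool) : tree_size (enc_seq enc_bool (drop n s)) <=
  tree_size (enc_seq enc_bool s).
  rewrite -{2}(cat_take_drop n s).
  have := enc_seq_cat_size enc_bool (take n s) (drop n s).
  by have := tree_size_gt0 (enc_seq enc_bool (take n s)); lia.
have H1 : polytime f (fun x => enc1 (st x)).
  apply: (@polytime_foldl X f (fun=> bool) (fun=> seq bool * seq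
    (bool * bool))%type
   (fun=> enc_bool) (fun=> enc1) a (fun x => (b x, [::])) (fun=> step1)
   (fun x => Lb x + 8 * La x + 2)) => //.
  - exact: polytime_cons Hb (polytime_nil _).
  - move=> Y h s t; apply: polytime_comp (polytime_snd _ _) _.
    set ctx := (fun y : Y => _).
    have Hr : polytime ctx (fun y => enc_seq enc_bool (s y).1).
      exact: (polytime_comp (polytime_fst _ _) (polytime_fst _ _)).
    apply: polytime_cons.
      by apply: polytime_ext (polytime_tl Hr) => y /=; case: (s y).1.
    apply: polytime_cons; last exact: (polytime_comp (polytime_fst _ _)
      (polytime_snd _ _)).
    apply: polytime_cons; first exact: polytime_snd.
    by apply: polytime_ext (polytime_hd Hr) => y /=; case: (s y).1.
  - apply: pbound_add; last exact: pbound_const.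
    apply: pbound_add => //.
    by apply: pbound_mul => //; apply: pbound_const.
  - move=> x pre suf ax; case: (foldl _ _ pre)
    (stE pre x [::]) => r o /= [-> so].
    have := size_enc_pairs_le o; rewrite so.
    have := drop_le (size pre) (b x).
    have := size_le_enc_seq enc_bool (a x); rewrite /La /Lb /fsize ax size_cat.
    by lia.
suff Hr : polytime f (fun x => enc_seq enc_pair (rev (padzip (a x) (b x)))).
  by apply: polytime_ext (polytime_rev Hr) => x; rewrite revK.
apply: (@polytime_ext _ _ (fun x => enc_seq enc_pair
   (foldl (fun o t => (false, t) :: o) (st x).2 (st x).1))).
  by move=> x; rewrite /st (padzip_foldl (a x) (b x) [::]) cats0.
apply: polytime_comp H1 _.
apply: (@polytime_foldl X _ (fun=> bool) (fun=> seq (bool * bool))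
   (fun=> enc_bool) (fun=> enc_seq enc_pair) (fun x => (st x).1) (fun x =>
     (st x).2)
   (fun=> (fun o t => (false, t) :: o)) (fun x => 8 * fsize (fun x => enc1
     (st x)) x + 1)).
- exact: polytime_fst.
- exact: polytime_snd.
- move=> Y h s t; apply: polytime_comp (polytime_snd _ _) _.
  apply: polytime_cons; last exact: polytime_fst.
  exact: polytime_cons (polytime_nil _) (polytime_snd _ _).
- apply: pbound_add; last exact: pbound_const.
  by apply: pbound_mul; [exact: pbound_const | exact: pbound_id].
- move=> x pre suf sx; apply: leq_trans (size_enc_pairs_le _) _.
  have -> : size (foldl (fun o t => (false, t) :: o) (st x).2 pre) =
    size (st x).2 + size pre.
    by elim/last_ind: pre {sx} => [|l t IH];
      rewrite ?addn0 // foldl_rcons /= IH size_rcons addnS.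
  have := size_le_enc_seq enc_bool (st x).1.
  have := size_le_enc_seq enc_pair (st x).2.
  by rewrite /enc1 /fsize /= sx size_cat; lia.
Qed.

(** Addition emits its bits most significant first. One more pass pushes them back into
    little-endian order and skips the leading zeros, which it meets while its output is still
    empty. *)
Lemma polytime_trimrev X (f : X -> tree) (s : X -> seq bool) :
  polytime f (fun x => enc_seq enc_bool (rev (s x))) ->
  polytime f (fun x => enc_nat (bval (s x))).
Proof.
move=> Hs.
pose step (o : seq bool) (b : bool) :=
  if b then b :: o else if o is [::] then [::] else b :: o.
apply: (@polytime_ext _ _ (fun x => enc_seq enc_bool (foldl step [::] (rev
  (s x))))).
  by move=> x; rewrite foldl_rev /enc_nat nat_bits_bval.
apply: (@polytime_foldl X f (fun=> bool) (fun=> seq bool)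
   (fun=> enc_bool) (fun=> enc_seq enc_bool) (fun x => rev (s x)) (fun=> [::])
   (fun=> step) (fun x => 4 * fsize (fun x => enc_seq enc_bool (rev
     (s x))) x + 1)) => //.
- exact: polytime_nil.
- move=> Y h o t; apply: polytime_comp (polytime_snd _ _) _.
  set ctx := (fun y : Y => _).
  have Ho : polytime ctx (fun y => enc_seq enc_bool (o y))
    by apply: polytime_fst.
  have Ht : polytime ctx (fun y => enc_bool (t y)) by apply: polytime_snd.
  have Hc := polytime_cons Ht Ho.
  apply: polytime_ext (polytime_if Ht Hc (polytime_ifnil Ho Hc
    (polytime_nil ctx))) => y.
  by rewrite /step; case: (t y); case: (o y).
- apply: pbound_add; last exact: pbound_const.
  by apply: pbound_mul; [exact: pbound_const | exact: polytime_size].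
- move=> x pre suf sx; apply: leq_trans (size_enc_bits_le _) _.
  have : size (foldl step [::] pre) <= size pre.
    elim/last_ind: pre {sx} => [|l t IH] //;
      rewrite foldl_rcons size_rcons {1}/step.
    by case: t; case: (foldl _ _ l) IH => //= *; lia.
  have := size_le_enc_seq enc_bool (rev (s x)).
  by rewrite /fsize /= sx size_cat; lia.
Qed.

(** A full adder: the new carry is the majority of the two bits and the old carry, and the sum bit
    is pushed onto the output. *)
Definition add_step (st : bool * seq bool) (p : bool * bool) :
  bool * seq bool :=
  (if p.1 then p.2 || st.1 else p.2 && st.1, (p.1 (+) (p.2 (+) st.1)) :: st.2).

Lemma add_stepP z :
  bval (rev (let st := foldl add_step (false, [::]) z in st.1 :: st.2)) =
  bval (unzip1 z) + bval (unzip2 z).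
Proof.
have bval_cat s1 s2 : bval (s1 ++ s2) = bval s1 + 2 ^ size s1 * bval s2.
  elim: s1 => [|b s1 IH] /=; first by rewrite mul1n.
  by rewrite IH expnS; case: b; lia.
(* Invariant: the emitted bits, plus the carry at position [size z], account for the sum of the bits
   read. *)
have H : size (foldl add_step (false, [::]) z).2 = size z /\
    bval (rev (foldl add_step (false, [::]) z).2) +
    2 ^ size z * (foldl add_step (false, [::]) z).1 =
    bval (unzip1 z) + bval (unzip2 z).
  elim/last_ind: z => [|z [u v] [IH1 IH2]] //.
  rewrite /unzip1 /unzip2 !map_rcons -!cats1 !bval_cat !size_map.
  rewrite cats1 foldl_rcons size_rcons.
  case: (foldl _ _ z) IH1 IH2 => c o /= so IH; rewrite so; split=> //.
  rewrite rev_cons -cats1 bval_cat size_rev so /= expnS.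
  move: IH; rewrite /unzip1 /unzip2;
    move: (bval _) (bval _) (bval _) => A1 A2 A3.
  move: (2 ^ _) => K.
  by case: u; case: v; case: c => /=; lia.
case: (foldl _ _ z) H => c o /= [so <-].
by rewrite rev_cons -cats1 bval_cat size_rev so /=; congr (_ + _ * _); case: c.
Qed.

Lemma polytime_add X (f : X -> tree) (a b : X -> nat) :
  polytime f (fun x => enc_nat (a x)) -> polytime f (fun x => enc_nat (b x)) ->
  polytime f (fun x => enc_nat (a x + b x)).
Proof.
move=> Ha Hb; pose z x := padzip (nat_bits (a x)) (nat_bits (b x)).
have Hz : polytime f (fun x => enc_seq enc_pair (z x))
  by apply: polytime_padzip.
pose st x := foldl add_step (false, [::]) (z x).
apply: (@polytime_ext _ _ (fun x => enc_nat (bval (rev ((st x).1 ::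
  (st x).2))))).
  by move=> x; rewrite add_stepP bval_padzip1 bval_padzip2 !bval_nat_bits.
apply: polytime_trimrev.
apply: (@polytime_ext _ _ (fun x => Cons (enc_bool (st x).1)
  (enc_seq enc_bool (st x).2))).
  by move=> x; rewrite revK.
apply: (@polytime_foldl X f (fun=> (bool * bool)%type) (fun=>
  (bool * seq bool)%type)
   (fun=> enc_pair) (fun _ p => Cons (enc_bool p.1) (enc_seq enc_bool p.2)) z
     (fun=> (false, [::]))
   (fun=> add_step) (fun x => 4 * fsize (fun x => enc_seq enc_pair
     (z x)) x + 5)) => //.
- exact: polytime_const.
- move=> Y h s t; apply: polytime_comp (polytime_snd _ _) _.
  set ctx := (fun y : Y => _).
  have Hc : polytime ctx (fun y => enc_bool (s y).1).
    exact: (polytime_comp (polytime_fst _ _) (polytime_fst _ _)).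
  have Ho : polytime ctx (fun y => enc_seq enc_bool (s y).2).
    exact: (polytime_comp (polytime_fst _ _) (polytime_snd _ _)).
  have Hu : polytime ctx (fun y => enc_bool (t y).1).
    exact: (polytime_comp (polytime_snd _ _) (polytime_fst _ _)).
  have Hv : polytime ctx (fun y => enc_bool (t y).2).
    exact: (polytime_comp (polytime_snd _ _) (polytime_snd _ _)).
  apply: polytime_cons; last first.
    exact: polytime_cons (polytime_xor Hu (polytime_xor Hv Hc)) Ho.
  apply: polytime_ext (polytime_if Hu (polytime_or Hv Hc)
    (polytime_and Hv Hc)) => y.
  by rewrite /=; case: ifP.
- apply: pbound_add; last exact: pbound_const.
  by apply: pbound_mul; [exact: pbound_const | exact: polytime_size].
- move=> x pre suf sx /=.
  have : size (foldl add_step (false, [::]) pre).2 = size pre.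
    by elim/last_ind: pre {sx} => [|l t IH] //;
      rewrite foldl_rcons size_rcons /= IH.
  case: (foldl _ _ pre) => c o /= so.
  have := size_enc_bits_le o; have := tree_size_enc_bool c.
  have := size_le_enc_seq enc_pair (z x).
  by rewrite /fsize /= sx size_cat; lia.
Qed.

(** The scan goes from low to high bits: [r] is the verdict so far, and a later, more significant
    differing pair overrides it. A negative verdict on the low part makes the comparison of the rest
    strict, whence the term [~~ r]. *)
Lemma leq_foldlP z (r : bool) :
  foldl (fun (r : bool) (p : bool * bool) => if p.1
    (+) p.2 then p.2 else r) r z =
  (bval (unzip1 z) + ~~ r <= bval (unzip2 z)).
Proof.
elim: z r => [|[u v] z IH] r /=; first by case: r.
by rewrite IH; case: u; case: v; case: r => /=; lia.
Qed.

Lemma polytime_leq X (f : X -> tree) (a b : X -> nat) :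
  polytime f (fun x => enc_nat (a x)) -> polytime f (fun x => enc_nat (b x)) ->
  polytime f (fun x => enc_bool (a x <= b x)).
Proof.
move=> Ha Hb; pose z x := padzip (nat_bits (a x)) (nat_bits (b x)).
have Hz : polytime f (fun x => enc_seq enc_pair (z x))
  by apply: polytime_padzip.
pose step (r : bool) (p : bool * bool) := if p.1 (+) p.2 then p.2 else r.
apply: (@polytime_ext _ _ (fun x => enc_bool (foldl step true (z x)))).
  by move=> x; rewrite leq_foldlP bval_padzip1 bval_padzip2 !bval_nat_bits
    addn0.
apply: (@polytime_foldl X f (fun=> (bool * bool)%type) (fun=> bool)
   (fun=> enc_pair) (fun=> enc_bool) z (fun=> true) (fun=> step)
     (fun=> 3)) => //.
- exact: polytime_const.
- move=> Y h s t; apply: polytime_comp (polytime_snd _ _) _.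
  set ctx := (fun y : Y => _).
  have Hc : polytime ctx (fun y => enc_bool (s y)) by apply: polytime_fst.
  have Hu : polytime ctx (fun y => enc_bool (t y).1).
    exact: (polytime_comp (polytime_snd _ _) (polytime_fst _ _)).
  have Hv : polytime ctx (fun y => enc_bool (t y).2).
    exact: (polytime_comp (polytime_snd _ _) (polytime_snd _ _)).
  apply: polytime_ext (polytime_if (polytime_xor Hu Hv) Hv Hc) => y.
  by rewrite /step; case: ifP.
- exact: pbound_const.
- by move=> *; apply: tree_size_enc_bool.
Qed.

(** Shift-and-add multiplication. The second component is doubled once per bit read, so it gains one
    bit per step and the state keeps linear size. *)
Lemma mul_foldlP s n m :
  foldl (fun (p : nat * nat) (b :
    bool) => (if b then p.1 + p.2 else p.1, p.2 + p.2)) (n, m) s =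
  (n + bval s * m, 2 ^ size s * m).
Proof.
elim: s n m => [|b s IH] n m /=; first by rewrite addn0 mul1n.
by rewrite IH expnS; case: b; congr (_, _) => /=; lia.
Qed.

Lemma polytime_mul X (f : X -> tree) (a b : X -> nat) :
  polytime f (fun x => enc_nat (a x)) -> polytime f (fun x => enc_nat (b x)) ->
  polytime f (fun x => enc_nat (a x * b x)).
Proof.
move=> Ha Hb.
pose step (p : nat * nat) (b : bool) :=
  (if b then p.1 + p.2 else p.1, p.2 + p.2).
pose enc2 (p : nat * nat) := Cons (enc_nat p.1) (enc_nat p.2).
apply: (@polytime_ext _ _ (fun x => tree_hd (enc2 (foldl step (0, b x)
  (nat_bits (a x)))))).
  by move=> x; rewrite mul_foldlP bval_nat_bits.
apply: polytime_hd.
apply: (@polytime_foldl X f (fun=> bool) (fun=> (nat * nat)%type)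
   (fun=> enc_bool) (fun=> enc2) (fun x => nat_bits (a x)) (fun x =>
     (0, b x)) (fun=> step)
   (fun x => 8 * (fsize (fun x => enc_nat (a x)) x + fsize (fun x => enc_nat
     (b x)) x) + 3)) => //.
- exact: polytime_cons (polytime_const _ _) Hb.
- move=> Y h s t; apply: polytime_comp (polytime_snd _ _) _.
  set ctx := (fun y : Y => _).
  have H1 : polytime ctx (fun y => enc_nat (s y).1).
    exact: (polytime_comp (polytime_fst _ _) (polytime_fst _ _)).
  have H2 : polytime ctx (fun y => enc_nat (s y).2).
    exact: (polytime_comp (polytime_fst _ _) (polytime_snd _ _)).
  have Ht : polytime ctx (fun y => enc_bool (t y)) by apply: polytime_snd.
  apply: polytime_cons; last exact: polytime_add.
  apply: polytime_ext (polytime_if Ht (polytime_add H1 H2) H1) => y.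
  by rewrite /step /=; case: ifP.
- apply: pbound_add; last exact: pbound_const.
  apply: pbound_mul; first exact: pbound_const.
  by apply: pbound_add; apply: polytime_size.
- move=> x pre suf ax; rewrite mul_foldlP add0n /=.
  set N := fsize _ _ + fsize _ _.
  have sp : 2 ^ size pre * b x < 2 ^ N.
    have le : 2 ^ size pre <= 2 ^ fsize (fun x => enc_nat (a x)) x.
      rewrite leq_exp2l //.
      have := size_le_enc_seq enc_bool (nat_bits (a x)).
      by rewrite /fsize /enc_nat ax size_cat; lia.
    rewrite expnD; apply: leq_ltn_trans (leq_mul le (leqnn _)) _.
    by rewrite ltn_pmul2l ?expn_gt0 //; apply: lt_size_enc_nat.
  have := size_enc_nat_le sp.
  have /size_enc_nat_le : bval pre * b x < 2 ^ N.
    by apply: leq_ltn_trans sp; rewrite leq_mul // ltnW // bval_lt.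
  by lia.
Qed.

(** * Fractions and sets of vertices *)

(** Fractions are left unreduced, so that addition and comparison need only natural number
    arithmetic and no gcd. [enc_frac (rfrac q)] is convertible to [enc_rat q], so the input is read
    directly as fractions. *)
Definition frac := (nat * nat)%type.
Definition enc_frac (p : frac) : tree := Cons (enc_nat p.1) (enc_nat p.2).
Definition fval (p : frac) : rat := (p.1%:R / p.2%:R)%R.
Definition rfrac (q : rat) : frac := (`|numq q|%N, `|denq q|%N).
Definition fadd (p q : frac) : frac := (p.1 * q.2 + q.1 * p.2, p.2 * q.2).
Definition fle (p q : frac) : bool := p.1 * q.2 <= q.1 * p.2.

Lemma rfrac_gt0 q : 0 < (rfrac q).2.
Proof. by rewrite absz_gt0 denq_neq0. Qed.

Lemma fval_rfrac q : (0 <= q)%R -> fval (rfrac q) = q.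
Proof.
move=> q0; rewrite /fval /= -[in RHS](divq_num_den q) !pmulrn.
by rewrite !abszE ger0_norm ?numq_ge0 // gtr0_norm ?denq_gt0.
Qed.

Lemma fval_fadd p q : 0 < p.2 -> 0 < q.2 ->
  fval (fadd p q) = (fval p + fval q)%R.
Proof.
move=> p0 q0; rewrite /fval /= natrD !natrM addf_div // pnatr_eq0 -lt0n //.
Qed.

Lemma fle_fval p q : 0 < p.2 -> 0 < q.2 -> fle p q = (fval p <= fval q)%R.
Proof.
move=> p0 q0; rewrite /fle /fval ler_pdivrMr ?ltr0n // mulrAC.
by rewrite ler_pdivlMr ?ltr0n // -!natrM ler_nat.
Qed.

Lemma polytime_fadd X (f : X -> tree) (p q : X -> frac) :
  polytime f (fun x => enc_frac (p x)) ->
    polytime f (fun x => enc_frac (q x)) ->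
  polytime f (fun x => enc_frac (fadd (p x) (q x))).
Proof.
move=> Hp Hq; have [Hp1 Hp2] := (polytime_hd Hp, polytime_tl Hp).
have [Hq1 Hq2] := (polytime_hd Hq, polytime_tl Hq).
apply: polytime_cons; last exact: polytime_mul.
by apply: polytime_add; apply: polytime_mul.
Qed.

Lemma polytime_fle X (f : X -> tree) (p q : X -> frac) :
  polytime f (fun x => enc_frac (p x)) ->
    polytime f (fun x => enc_frac (q x)) ->
  polytime f (fun x => enc_bool (fle (p x) (q x))).
Proof.
move=> Hp Hq; have [Hp1 Hp2] := (polytime_hd Hp, polytime_tl Hp).
have [Hq1 Hq2] := (polytime_hd Hq, polytime_tl Hq).
by apply: polytime_leq; apply: polytime_mul.
Qed.

Definition wfrac (V : finType) (w : V ->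
  rat) (S : {set V}) (l : seq V) : frac :=
  foldl (fun acc v => if v \in S then fadd acc (rfrac (w v)) else acc) (0, 1) l.

Lemma wfrac_gt0 (V : finType) (w : V ->
  rat) (S : {set V}) l : 0 < (wfrac w S l).2.
Proof.
elim/last_ind: l => [|l v IH] //; rewrite /wfrac foldl_rcons; case: ifP => // _.
by rewrite muln_gt0 rfrac_gt0 andbT.
Qed.

Lemma fval_wfrac (V : finType) (w : V -> rat) (S : {set V}) :
  (forall v, 0 <= w v)%R -> fval (wfrac w S (enum V)) = weight w S.
Proof.
move=> w0.
have sumE l : fval (wfrac w S l) = (\sum_(v <- l | v \in S) w v)%R.
  elim/last_ind: l => [|l v IH]; first by rewrite big_nil.
  rewrite -cats1 big_cat /= -IH big_mkcond big_seq1 cats1 /wfrac foldl_rcons.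
  case: ifP => _; last by rewrite addr0.
  by rewrite fval_fadd ?rfrac_gt0 ?wfrac_gt0 // fval_rfrac.
by rewrite sumE big_enum_cond.
Qed.

(* Fractions are not reduced; the sum of numerator and denominator is
   submultiplicative under [fadd], which keeps their bit length linear. *)
Lemma wfrac_lt (V : finType) (w : V -> rat) (S : {set V}) l :
  (wfrac w S l).1 + (wfrac w S l).2 <
    2 ^ tree_size (enc_seq (fun v => enc_rat (w v)) l).
Proof.
elim/last_ind: l => [|l v IH] //; rewrite -cats1.
have EE : tree_size (enc_seq (fun v => enc_rat (w v)) (l ++ [:: v])) =
    tree_size (enc_seq (fun v => enc_rat (w v)) l) + (tree_size (enc_rat
      (w v))).+1.
  apply: succn_inj; rewrite enc_seq_cat_size -addnS; congr addn.
  by rewrite size_enc_seq big_seq1.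
rewrite EE cats1 /wfrac foldl_rcons -/(wfrac _ _ _); case: ifP => _; last first.
  by apply: leq_trans IH _; rewrite leq_exp2l // leq_addr.
have : (rfrac (w v)).1 + (rfrac (w v)).2 < 2 ^ (tree_size (enc_rat (w v))).+1.
  have -> : tree_size (enc_rat (w v)) =
    (tree_size (enc_nat (rfrac (w v)).1) + tree_size (enc_nat (rfrac
      (w v)).2)).+1 by [].
  have := lt_size_enc_nat (rfrac (w v)).2;
    have := lt_size_enc_nat (rfrac (w v)).1.
  set a := tree_size (enc_nat (_.1)); set b := tree_size (enc_nat (_.2)).
  move: (rfrac (w v)).1 (rfrac (w v)).2 => n d Ha Hb.
  have a2 : 2 ^ a <= 2 ^ (a + b) by rewrite leq_exp2l // leq_addr.
  have b2 : 2 ^ b <= 2 ^ (a + b) by rewrite leq_exp2l // leq_addl.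
  by rewrite !expnS; move: (2 ^ a) (2 ^ b) (2 ^ (a + b)) Ha Hb a2 b2 => *; lia.
move: (rfrac (w v)) (wfrac w S l) IH => [n d] [n' d'] /= IH nd.
apply: leq_ltn_trans (_ : _ <= (n' + d') * (n + d)) _; first by nia.
by rewrite expnD ltn_mul.
Qed.

Lemma polytime_wfrac X (f : X -> tree) (V : X ->
  finType) (w : forall x, V x -> rat)
    (S : forall x, {set V x}) :
  polytime f (fun x => enc_seq (fun v => enc_rat (w x v)) (enum (V x))) ->
  polytime f (fun x => enc_set (S x)) ->
  polytime f (fun x => enc_frac (wfrac (w x) (S x) (enum (V x)))).
Proof.
move=> Hw HS; have Hz := polytime_zip Hw HS.
pose e x (v : V x) := Cons (enc_rat (w x v)) (enc_bool (v \in S x)).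
apply: (@polytime_foldl X f V (fun=> frac) e (fun=> enc_frac) (fun x => enum
  (V x))
   (fun=> (0, 1)) (fun x acc v => if v \in S x then fadd acc (rfrac
     (w x v)) else acc)
   (fun x => 8 * fsize (fun x => enc_seq (fun v => enc_rat (w x v)) (enum
     (V x))) x + 3)) => //.
- exact: polytime_const.
- move=> Y h s t; apply: polytime_comp (polytime_snd _ _) _.
  set ctx := (fun y : Y => _).
  have Hs : polytime ctx (fun y => enc_frac (s y)) by apply: polytime_fst.
  have Hr : polytime ctx (fun y => enc_frac (rfrac (w _ (t y)))).
    exact: (polytime_comp (polytime_snd _ _) (polytime_fst _ _)).
  have Hb : polytime ctx (fun y => enc_bool (t y \in S (h y))).
    exact: (polytime_comp (polytime_snd _ _) (polytime_snd _ _)).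
  apply: polytime_ext (polytime_if Hb (polytime_fadd Hs Hr) Hs) => y.
  by case: ifP.
- apply: pbound_add; last exact: pbound_const.
  by apply: pbound_mul; [exact: pbound_const | exact: polytime_size].
- move=> x pre suf lx; rewrite -/(wfrac _ _ _) /=.
  have := enc_seq_cat_size (fun v => enc_rat (w x v)) pre suf.
  have := tree_size_gt0 (enc_seq (fun v => enc_rat (w x v)) suf).
  have := wfrac_lt (w x) (S x) pre; set N := tree_size (enc_seq _ pre).
  case: (wfrac _ _ _) => n d /= lt gt0 eN.
  have /size_enc_nat_le : n < 2 ^ N by apply: leq_ltn_trans lt;
    rewrite leq_addr.
  have /size_enc_nat_le : d < 2 ^ N by apply: leq_ltn_trans lt;
    rewrite leq_addl.
  by rewrite /fsize lx; lia.
Qed.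

(** * Operations on characteristic vectors *)

Lemma eq_enc_seq (T : Type) (e e' : T -> tree) (l : seq T) :
  e =1 e' -> enc_seq e l = enc_seq e' l.
Proof. by move=> ee; elim: l => //= a l ->; rewrite ee. Qed.

Lemma size_enc_set_le (V : finType) (S : {set V}) :
  tree_size (enc_set S) <= 4 * #|V| + 1.
Proof.
rewrite /enc_set cardE; elim: (enum V) => //= v l IH.
by have := tree_size_enc_bool (v \in S); lia.
Qed.

Lemma polytime_setU X (f : X -> tree) (V : X ->
  finType) (S T : forall x, {set V x}) :
  polytime f (fun x => enc_set (S x)) -> polytime f (fun x => enc_set (T x)) ->
  polytime f (fun x => enc_set (S x :|: T x)).
Proof.
move=> HS HT; have Hz := polytime_zip HS HT.
apply: (polytime_map Hz) => Y h t; apply: polytime_comp (polytime_snd _ _) _.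
apply: (@polytime_ext _ _ (fun y => enc_bool ((t y \in S (h y)) || (t y \in T
  (h y))))).
  by move=> y; rewrite inE.
by apply: polytime_or; [apply: polytime_fst | apply: polytime_snd].
Qed.

Lemma polytime_subset X (f : X -> tree) (V : X ->
  finType) (S T : forall x, {set V x}) :
  polytime f (fun x => enc_set (S x)) -> polytime f (fun x => enc_set (T x)) ->
  polytime f (fun x => enc_bool (S x \subset T x)).
Proof.
move=> HS HT; have Hz := polytime_zip HS HT.
apply: (@polytime_ext _ _ (fun x => enc_bool
    (all (fun v => ~~ (v \in S x) || (v \in T x)) (enum (V x))))).
  move=> x; congr enc_bool; apply/allP/subsetP => [H v vS | H v _].
    by have := H v (mem_enum _ _); rewrite vS.
  by case: (boolP (v \in S x)) => // /H ->.
apply: (polytime_all (P := fun x v => ~~ (v \in S x) ||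
  (v \in T x)) Hz) => Y h t; apply: polytime_comp (polytime_snd _ _) _.
by apply: polytime_or; [apply: polytime_not;
  apply: polytime_fst | apply: polytime_snd].
Qed.

Lemma polytime_set0 X (f : X -> tree) (V : X -> finType) (e : forall x, V x ->
  tree) :
  polytime f (fun x => enc_seq (@e x) (enum (V x))) ->
  polytime f (fun x => enc_set (set0 : {set V x})).
Proof.
move=> H; apply: (polytime_map H) => Y h t.
by apply: polytime_ext (polytime_nil _) => y; rewrite inE.
Qed.

Lemma polytime_setT X (f : X -> tree) (V : X -> finType) (e : forall x, V x ->
  tree) :
  polytime f (fun x => enc_seq (@e x) (enum (V x))) ->
  polytime f (fun x => enc_set (setT : {set V x})).
Proof.
move=> H; apply: (polytime_map H) => Y h t.
by apply: polytime_ext (polytime_const _ (enc_bool true)) => y; rewrite inE.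
Qed.

(** Vertices have no names in the encoding; this builds the identity matrix, whose rows stand for
    the vertices inside the loops. *)
Lemma polytime_set1 X (f : X -> tree) (V : X -> finType) (e : forall x, V x ->
  tree) :
  polytime f (fun x => enc_seq (@e x) (enum (V x))) ->
  polytime f (fun x => enc_seq (fun v : V x => enc_set [set v]) (enum (V x))).
Proof.
move=> H; have Hr := polytime_rev H.
pose row x (l : seq (V x)) (v : V x) := enc_seq (fun y => enc_bool (v == y)) l.
(* The matrix grows from the last vertex backwards: each step puts a [false] in front of every row
   and adds a first row made of [true] and zeros. The zeros come from the first component, an
   all-false vector of the current length. *)
pose st x (pre suf : seq (V x)) :=
  Cons (enc_seq (fun=> Nil) pre) (enc_seq (row x (rev pre)) (rev pre)).
have eq_in (T : eqType) (a b : T -> tree) (l : seq T) : {in l, a =1 b} ->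
  enc_seq a l = enc_seq b l.
  elim: l => //= v l IH ab; rewrite ab ?mem_head // IH // => u ul.
  by rewrite ab // inE ul orbT.
have falses (T : Type) (l l' : seq T) : size l = size l' ->
    enc_seq (fun=> Nil) l = enc_seq (fun=> Nil) l'.
  by elim: l l' => [|u l IH] [|u' l'] //= [/IH->].
suff Hs : polytime f (fun x => st x (rev (enum (V x))) [::]).
  apply: (@polytime_ext _ _ _ _ _ (polytime_tl Hs)) => x; rewrite /= revK.
  apply: eq_enc_seq => v; apply: eq_enc_seq => y.
  by rewrite inE eq_sym.
pose N x := fsize (fun x => enc_seq (@e x) (rev (enum (V x)))) x.
have bN : pbound (fsize f) N by apply: polytime_size Hr.
apply: (@polytime_loop X f V e (fun x => rev (enum (V x))) st
  (fun x => 2 * N x + 1 + (N x * (4 * N x + 1 + 1) + 1) + 1)) => //.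
- by apply: (@polytime_ext _ _ (fun=> Cons Nil Nil)) => //;
  apply: polytime_const.
- move=> Y h pre suf t lx; apply: polytime_comp (polytime_snd _ _) _.
  apply: polytime_comp (polytime_fst _ _) _.
  have Hf : polytime (fun y => st (h y) (pre y) (t y :: suf y))
      (fun y => enc_seq (fun=> Nil) (pre y)) by apply: polytime_fst.
  have HM : polytime (fun y => st (h y) (pre y) (t y :: suf y))
      (fun y => enc_seq (row (h y) (rev (pre y))) (rev (pre y)))
        by apply: polytime_snd.
  have HM' := @polytime_map _ _ _ _ (fun y v => Cons Nil (row (h y) (rev
    (pre y)) v)) _ HM
    (fun Z g u => polytime_cons (polytime_nil _) (polytime_snd _ _)).
  apply: polytime_ext (polytime_cons (polytime_cons (polytime_nil _) Hf)
    (polytime_cons (polytime_cons (polytime_const _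
      (enc_bool true)) Hf) HM')) => y.
  have u : uniq (pre y ++ t y :: suf y) by rewrite -lx rev_uniq enum_uniq.
  have tp : t y \notin pre y.
    by move: u; rewrite cat_uniq /= negb_or => /and3P [_ /andP [] ].
  rewrite /st rev_rcons; congr (Cons _ (Cons _ _)).
  + by rewrite [LHS](falses _ (t y :: pre y) (rcons (pre y)
    (t y))) // size_rcons.
  + rewrite /row /= eqxx; congr (Cons _ _).
    rewrite (falses _ _ (rev (pre y))) ?size_rev //.
    apply: eq_in => z; rewrite mem_rev => zp.
    by case: eqP => // tz; rewrite tz zp in tp.
  + apply: eq_in => z; rewrite mem_rev => zp /=.
    by case: eqP => // tz; rewrite -tz zp in tp.
- apply: pbound_add; last exact: pbound_const.
  have bN4 : pbound (fsize f) (fun x => 4 * N x).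
    by apply: pbound_mul => //; apply: pbound_const.
  apply: pbound_add.
    apply: pbound_add; last exact: pbound_const.
    by apply: pbound_mul => //; apply: pbound_const.
  apply: pbound_add; last exact: pbound_const.
  apply: pbound_mul => //.
  apply: pbound_add; last exact: pbound_const.
  by apply: pbound_add => //; apply: pbound_const.
- move=> x pre suf lx.
  have pN : size pre <= N x.
    have := size_le_enc_seq (e x) (rev (enum (V x))).
    by rewrite /N /fsize lx size_cat; lia.
  have s1 : tree_size (enc_seq (fun=> Nil) pre) <= 2 * size pre + 1.
    by elim: (pre) => //= *; lia.
  have s2 v : tree_size (row x (rev pre) v) <= 4 * size pre + 1.
    rewrite -(size_rev pre) /row; elim: (rev pre) => //= z l IH.
    by have := tree_size_enc_bool (v == z); lia.
  have s3 l : tree_size (enc_seq (row x (rev pre)) l) <=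
    size l * (4 * size pre + 1 + 1) + 1.
    elim: l => //= v l IH; have := s2 v; rewrite mulSn; lia.
  have := s3 (rev pre); rewrite size_rev /= => s4.
  have : size pre * (4 * size pre + 1 + 1) <= N x * (4 * N x + 1 + 1).
    by apply: leq_mul => //; lia.
  by lia.
Qed.

(** * The approximation scheme *)

(** Take [v] in [D] reaching the fewest vertices. An arc from [v] to some [y] in [D] would force
    both to reach the same vertices, so a simple path from [y] back to [v] would close a circuit. *)
Lemma dag_sink (V : finType) (A : rel V) (D : {set V}) : dag A -> D != set0 ->
  exists2 v, v \in D & forall y, A v y -> y \notin D.
Proof.
move=> dagA /set0Pn [v0 v0D].
pose v := [arg min_(v < v0 in D) #|connect A v|].
have [vD vmin] : v \in D /\ forall y, y \in D ->
  #|connect A v| <= #|connect A y|.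
  by rewrite /v; case: arg_minnP.
exists v => // y Avy; apply/negP => yD.
have sub : connect A y \subset connect A v.
  by apply/subsetP => z; apply: connect_trans (connect1 Avy).
have vy : connect A y v.
  suff /subsetP : connect A v \subset connect A y by apply; apply: connect0.
  by rewrite -(geq_leqif (subset_leqif_card sub)) vmin.
have [p pth /esym lst] := connectP vy.
case: (shortenP pth) lst => q qpth uq _ lst.
apply: (dagA (y :: q)) => //; apply/andP; split=> //=.
by rewrite rcons_path qpth lst.
Qed.

Section Algorithm.
Variables (V : finType) (A : rel V) (w : V -> rat) (B : rat).
Implicit Types (P S T H : {set V}).

Definition out_nbrs (v : V) : {set V} := [set y | A v y].

(** The threshold [B / (k + 1)] with its denominator cleared, in the form the program tests. *)
Definition light_set (k : nat) : {set V} := [set v | k.+1%:R * w v <= B]%R.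

Definition try_add P S (v : V) : {set V} :=
  if [&& v \in P, out_nbrs v \subset S & (weight w (v |: S) <= B)%R]
  then v |: S else S.

Definition pass P S : {set V} := foldl (try_add P) S (enum V).

(** The vertex list serves only as a clock: [#|V|] passes are enough to reach a fixed point, and a
    fold over a list has a rule in the polynomial-time calculus. *)
Definition greedy P S : {set V} := foldl (fun T _ => pass P T) S (enum V).

Definition candidate k H : {set V} :=
  greedy setT (greedy (light_set k :|: H) set0).

Definition lighter S T : {set V} :=
  if (weight w S <= weight w T)%R then S else T.

(* The lightest among [best] and the candidates for [H] extended by at most
   [j] vertices. *)
Fixpoint search k j H best : {set V} :=
  if j is j'.+1 then
    foldl (fun b v => search k j' (v |: H) b) (search k j' H best) (enum V)
  else lighter best (candidate k H).

Definition ptas k : {set V} := search k k set0 (candidate k set0).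

Hypotheses (dagA : dag A) (w_ge0 : forall v, (0 <= w v)%R) (B_gt0 : (0 < B)%R).

Lemma weight_setU1 S v : v \notin S -> weight w (v |: S) = (w v + weight w S)%R.
Proof. exact: big_setU1. Qed.

Lemma weight_sub S T : S \subset T -> (weight w S <= weight w T)%R.
Proof.
move=> sST; rewrite /weight [leRHS](big_setID S) /= (setIidPr sST) lerDl.
exact: sumr_ge0.
Qed.

Lemma ssg_set0 : ssg_set A w B set0.
Proof. by split; [move=> x y; rewrite inE | rewrite /weight big_set0 ltW]. Qed.

Lemma ssg_setU1 S v : ssg_set A w B S -> out_nbrs v \subset S ->
  (weight w (v |: S) <= B)%R -> ssg_set A w B (v |: S).
Proof.
move=> [cS _] /subsetP ov le; split=> // x y /setU1P [->|xS] Axy;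
  apply/setU1P; right.
  by apply: ov; rewrite inE.
exact: cS xS Axy.
Qed.

(* A sink of the difference of two closed sets can be added to the smaller one. *)
Lemma addable_vertex S T : digraph_constraints A T -> S \proper T ->
  exists v, [/\ v \in T, v \notin S & out_nbrs v \subset S].
Proof.
move=> cT /properP [_ [x xT xS]].
have /(dag_sink dagA) [v] : T :\: S != set0 by apply/set0Pn; exists x;
  rewrite inE xS.
rewrite inE => /andP [vS vT] sink; exists v; split=> //.
apply/subsetP => y; rewrite inE => Avy; have := sink y Avy.
by rewrite inE (cT v y vT Avy) andbT negbK.
Qed.

(** * Saturation and the greedy procedure *)

Definition saturated P S : Prop := forall v, v \in P -> out_nbrs v \subset S ->
  (weight w (v |: S) <= B)%R -> v \in S.

(** A larger solution [T] contains a vertex [v] addable to [S]; as [v |: S] lies inside [T],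
    nonnegative weights keep it within the bound, against saturation. *)
Lemma feasible_saturated S : ssg_set A w B S -> saturated setT S ->
  feasible A w B S.
Proof.
move=> sS sat; split=> // T ST [cT wT].
have [v [vT vS ov]] := addable_vertex cT ST.
suff : v \in S by rewrite (negbTE vS).
apply: sat; rewrite ?inE //; apply: le_trans wT; apply: weight_sub.
by rewrite subUset sub1set vT proper_sub.
Qed.

Lemma try_add_sub P S v : S \subset try_add P S v.
Proof. by rewrite /try_add; case: ifP => // _; apply: subsetUr. Qed.

Lemma foldl_try_add_sub P S l : S \subset foldl (try_add P) S l.
Proof.
elim: l S => //= v l IH S; exact: subset_trans (try_add_sub P S v) (IH _).
Qed.

(** A pass only adds vertices, so if it ends at [S] it stayed at [S] throughout, and each vertex was
    tried against [S] itself. *)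
Lemma pass_fixed P S : pass P S = S -> saturated P S.
Proof.
move=> fixS v vP ov le.
have vV : v \in enum V by rewrite mem_enum.
move: fixS; rewrite /pass; case/splitPr: vV => l1 l2;
  rewrite foldl_cat /= => fixS.
have fix1 : foldl (try_add P) S l1 = S.
  apply/eqP; rewrite eqEsubset foldl_try_add_sub andbT.
  have := subset_trans (try_add_sub P (foldl (try_add P) S l1) v)
    (foldl_try_add_sub P _ l2).
  by rewrite fixS.
have := foldl_try_add_sub P (try_add P S v) l2; rewrite fix1 in fixS.
by rewrite fixS {1}/try_add vP ov le /= => /subsetP; apply; rewrite setU11.
Qed.

Lemma greedy_iter P S : greedy P S = iter #|V| (pass P) S.
Proof.
rewrite /greedy cardE; elim: (enum V) S => //= v l IH S.
by rewrite IH -iterS iterSr.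
Qed.

(** As long as the iterates change, each step gains a vertex: either the [n]-th iterate is fixed, or
    the next one has more than [n] elements, which is impossible at [n = #|V|]. *)
Lemma iter_inflationary_fixed (F : {set V} -> {set V}) S :
  (forall T, T \subset F T) -> F (iter #|V| F S) = iter #|V| F S.
Proof.
move=> infl.
have H n : F (iter n F S) = iter n F S \/ n < #|iter n.+1 F S|.
  elim: n => [|n [IH|IH]].
  - case: (eqVneq (F S) S) => [|ne]; [by left | right].
    rewrite /= card_gt0; apply: contraNneq ne => F0.
    by rewrite F0; apply/eqP/esym; apply/eqP; rewrite -subset0 -F0.
  - by left; rewrite /= !IH.
  - set T := iter n.+1 F S in IH *; case: (eqVneq (F T) T) => [|ne];
    [by left | right].
    rewrite /= -/(iter n.+1 F S) -/T; apply: leq_ltn_trans IH _.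
    by apply: proper_card; rewrite properEneq eq_sym ne infl.
have [//|lt] := H #|V|.
by have := max_card (mem (iter #|V|.+1 F S)); rewrite leqNgt lt.
Qed.

Lemma greedy_saturated P S : saturated P (greedy P S).
Proof.
apply: pass_fixed; rewrite greedy_iter; apply: iter_inflationary_fixed => T.
exact: foldl_try_add_sub.
Qed.

Lemma greedy_ind (Q : {set V} -> Prop) P S : Q S ->
  (forall T v, Q T -> v \in P -> out_nbrs v \subset T ->
    (weight w (v |: T) <= B)%R -> Q (v |: T)) ->
  Q (greedy P S).
Proof.
move=> Q0 Qs; rewrite greedy_iter; elim: #|V| => //= n.
move: (iter _ _ _) => T; rewrite /pass; elim: (enum V) T => //= v l IH T QT.
by apply: IH; rewrite /try_add; case: ifP => // /and3P [*]; apply: Qs.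
Qed.

Lemma greedy_ssg P S : ssg_set A w B S -> ssg_set A w B (greedy P S).
Proof. by move=> sS; apply: greedy_ind => // T v sT _; apply: ssg_setU1. Qed.

Lemma candidate_feasible k H : feasible A w B (candidate k H).
Proof.
apply: feasible_saturated; last exact: greedy_saturated.
by do 2!apply: greedy_ssg; apply: ssg_set0.
Qed.

Lemma greedy_feasible P S : feasible A w B S -> greedy P S = S.
Proof.
move=> [sS maxS]; apply: (@greedy_ind (fun T => T = S)) => // T v -> _ ov le.
apply/eqP; case: (boolP (v \in S)) => vS;
  first by rewrite eqEsubset subsetUr subUset sub1set vS subxx.
case: (maxS (v |: S)); last exact: ssg_setU1.
by rewrite properEneq subsetUr andbT; apply: contraNneq vS => ->;
  rewrite setU11.
Qed.

(* If [w(S) < kB/(k+1)], every vertex that can be added to the maximal set [S]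
   is heavy, so greedy addition of light vertices and heavy vertices of [S]
   rebuilds [S]. *)
Lemma candidate_exact k S : feasible A w B S ->
  (k.+1%:R * weight w S < k%:R * B)%R ->
  candidate k (S :\: light_set k) = S.
Proof.
move=> fS lt; have [[cS wS] maxS] := fS.
rewrite /candidate; set P := _ :|: _; set S1 := greedy P set0.
have sub : S1 \subset S.
  apply: (@greedy_ind (fun T => T \subset S)); first exact: sub0set.
  move=> T v sT; rewrite !inE => vP ov _; rewrite subUset sub1set sT andbT.
  case: (boolP (v \in S)) vP => //= vS; rewrite andbF orbF => light.
  case: (maxS (v |: S)).
    by rewrite properEneq subsetUr andbT; apply: contraNneq vS => ->;
      rewrite setU11.
  apply: ssg_setU1 => //; first exact: subset_trans ov sT.
  (* A light [v] outside [S] would fit, since [(k + 1) * (w v + weight w S) <= B + k * B]. *)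
  rewrite weight_setU1 // -(ler_pM2l (ltr0Sn _ k)) mulrDr.
  move: lt light; rewrite -natr1; lra.
suff -> : S1 = S by apply: greedy_feasible.
apply/eqP; rewrite eqEproper sub; apply/negP => ps.
have [v [vS vS1 ov]] := addable_vertex cS ps.
have : v \in S1; last by rewrite (negbTE vS1).
(* [P] contains all of [S]: a vertex of [S] is either light or in [S :\: light_set k]. *)
apply: greedy_saturated => //; first by rewrite !inE vS andbT orbN.
by apply: le_trans wS; apply: weight_sub; rewrite subUset sub1set vS proper_sub.
Qed.

(** More than [k] vertices, each heavier than [B / (k + 1)], would together exceed [B]. *)
Lemma card_heavy k S : (weight w S <= B)%R -> #|S :\: light_set k| <= k.
Proof.
move=> wS; rewrite leqNgt; apply/negP => gt.
set H := S :\: _ in gt.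
have : (k.+1%:R * weight w H <= k.+1%:R * B)%R.
  by rewrite ler_pM2l ?ltr0Sn //; apply: le_trans wS; apply: weight_sub;
    apply: subsetDl.
apply/negP; rewrite -ltNge; apply: le_lt_trans (_ : #|H|%:R * B < _)%R.
  by rewrite ler_pM2r // ler_nat.
rewrite /weight mulr_sumr mulr_natl -sumr_const; apply: ltr_sum.
  have /card_gt0P [v vH] : 0 < #|H| by apply: leq_trans gt.
  by apply/hasP; exists v => //; apply: mem_index_enum.
by move=> v; rewrite !inE => /andP [+ _]; rewrite -ltNge.
Qed.


(** * The exhaustive search and the approximation ratio *)

Lemma lighter_ind (Q : {set V} -> Prop) S T : Q S -> Q T -> Q (lighter S T).
Proof. by rewrite /lighter; case: ifP. Qed.

Lemma weight_lighter_l S T : (weight w (lighter S T) <= weight w S)%R.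
Proof. by rewrite /lighter; case: (leP (weight w S)) => // /ltW. Qed.

Lemma weight_lighter_r S T : (weight w (lighter S T) <= weight w T)%R.
Proof. by rewrite /lighter; case: (leP (weight w S)). Qed.

Lemma search_feasible k j H best :
  feasible A w B best -> feasible A w B (search k j H best).
Proof.
elim: j H best => [|j IH] H best fb /=.
  by apply: lighter_ind => //; apply: candidate_feasible.
elim: (enum V) (search k j H best) (IH H best fb) => //= v l IHl b fb'.
by apply: IHl; apply: IH.
Qed.

Lemma foldl_search_le k j H best l :
  (forall H b, (weight w (search k j H b) <= weight w b)%R) ->
  (weight w (foldl (fun b v => search k j (v |: H) b) best l) <=
    weight w best)%R.
Proof.
move=> le; elim: l best => //= v l IH best; exact: le_trans (IH _) (le _ _).
Qed.

Lemma search_le k j H best : (weight w (search k j H best) <= weight w best)%R.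
Proof.
elim: j H best => [|j IH] H best /=; first exact: weight_lighter_l.
exact: le_trans (foldl_search_le _ _ _ IH) (IH _ _).
Qed.

(** If [H'] contains [v], the iteration at [v] starts from [v |: H] and only has [H' :\ v] left to
    find; later iterations never make the best set heavier. An empty [H'] is covered by the search
    made before the loop. *)
Lemma search_le_candidate k j H H' best : #|H'| <= j ->
  (weight w (search k j H best) <= weight w (candidate k (H' :|: H)))%R.
Proof.
elim: j H H' best => [|j IH] H H' best.
  by rewrite leqn0 cards_eq0 => /eqP ->; rewrite set0U; apply: weight_lighter_r.
move=> le /=; have [->|[v vH']] := set_0Vmem H'.
  apply: le_trans (foldl_search_le _ _ _ (search_le k j)) _.
  by apply: IH; rewrite cards0.
have vV : v \in enum V by rewrite mem_enum.
case/splitPr: vV => l1 l2; rewrite foldl_cat /=.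
apply: le_trans (foldl_search_le _ _ _ (search_le k j)) _.
have -> : H' :|: H = (H' :\ v) :|: (v |: H)
  by rewrite setUA [_ :\ v :|: _]setUC setD1K.
by apply: IH; move: le; rewrite (cardsD1 v) vH'.
Qed.

(** Feasibility is decided by a boolean test on the finitely many vertex sets, and a candidate
    passes it, so a minimum is attained. *)
Lemma exists_optimal : exists opt, optimal_value A w B opt.
Proof.
pose closedb S := [forall x, forall y, (x \in S) ==> A x y ==> (y \in S)].
pose ssgb S := closedb S && (weight w S <= B)%R.
have ssgP S : reflect (ssg_set A w B S) (ssgb S).
  apply: (iffP andP) => [[cS wS]|[cS wS]]; split=> //.
    by move=> x y xS Axy; move/forallP/(_ x)/forallP/(_ y): cS; rewrite xS Axy.
  by apply/'forall_forallP => x y; apply/implyP => xS; apply/implyP; apply: cS.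
pose feasb S := ssgb S && [forall T : {set V}, (S \proper T) ==> ~~ ssgb T].
have feasP S : reflect (feasible A w B S) (feasb S).
  apply: (iffP andP) => [[/ssgP sS mS]|[/ssgP sS mS]]; split=> //.
    by move=> T ST /ssgP sT; move/forallP/(_ T): mS; rewrite ST sT.
  by apply/forallP => T; apply/implyP => /mS nT; apply/ssgP.
have f0 : feasb (candidate 0 set0) by apply/feasP/candidate_feasible.
have [S /feasP fS Smin] := arg_minP (fun S => weight w S) f0.
exists (weight w S); split; first by exists S.
by move=> T /feasP /Smin.
Qed.

Lemma ptas_feasible k : feasible A w B (ptas k).
Proof. by apply: search_feasible; apply: candidate_feasible. Qed.

Lemma ptas_ratio k opt : 0 < k -> optimal_value A w B opt ->
  (weight w (ptas k) <= k.+1%:R / k%:R * opt)%R.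
Proof.
move=> k0 [[S fS <-] _].
have kR : (0 < k%:R :> rat)%R by rewrite ltr0n.
rewrite mulrAC ler_pdivlMr // mulrC.
(* Heavy optimum: the output weighs at most [B], which is already within the ratio. *)
have [le|lt] := lerP (k%:R * B) (k.+1%:R * weight w S).
  apply: le_trans le; rewrite ler_pM2l //.
  by have [[_]] := ptas_feasible k.
(* Light optimum: the search meets the heavy part of [S], whose candidate is [S], so the output is
   no heavier than [S]. *)
have := search_le_candidate k set0 (candidate k set0) (card_heavy k fS.1.2).
rewrite setU0 candidate_exact // -/(ptas k) => le.
apply: le_trans (_ : _ <= k%:R * weight w S)%R _; first by rewrite ler_pM2l.
by rewrite ler_wpM2r ?ler_nat // sumr_ge0.
Qed.

End Algorithm.

(** * Polynomial running time *)

(** Instances on all vertex types form one index type, so that [polytime] over it provides a single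
    program. Nonnegativity is recorded because [enc_rat] drops signs. *)
Record instance := Instance {
  iV : finType;
  iA : rel iV;
  iw : iV -> rat;
  iB : rat;
  iw_ge0 : forall v, (0 <= iw v)%R;
  iB_ge0 : (0 <= iB)%R }.

Definition enc_inst (I : instance) : tree :=
  enc_instance (@iA I) (@iw I) (iB I).

Section PolytimeAlgorithm.
Variables (X : Type) (f : X -> tree) (I : X -> instance).
Hypothesis fI : polytime f (fun x => enc_inst (I x)).

Lemma polytime_bound : polytime f (fun x => enc_rat (iB (I x))).
Proof. exact: (polytime_hd fI). Qed.

Lemma polytime_weights :
  polytime f (fun x => enc_seq (fun v => enc_rat (@iw (I x) v)) (enum (iV
    (I x)))).
Proof. exact: (polytime_hd (polytime_tl fI)). Qed.

Lemma pbound_card : pbound (fsize f) (fun x => #|iV (I x)|).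
Proof.
apply: pbound_le (polytime_size polytime_weights) => x.
by rewrite cardE; apply: size_le_enc_seq.
Qed.

(** The list driving the vertex loops: each entry gives the body the current vertex, as a singleton,
    together with its out-neighbours. *)
Lemma polytime_vertices : polytime f (fun x =>
  enc_seq (fun v => Cons (enc_set [set v]) (enc_set (out_nbrs (@iA (I x)) v)))
          (enum (iV (I x)))).
Proof.
apply: polytime_zip; first exact: polytime_set1 polytime_weights.
apply: polytime_ext (polytime_tl (polytime_tl fI)) => x /=.
by apply: eq_enc_seq => v; apply: eq_enc_seq => y; rewrite inE.
Qed.

Lemma polytime_weight_le_bound (S : forall x, {set iV (I x)}) :
  polytime f (fun x => enc_set (S x)) ->
  polytime f (fun x => enc_bool (weight (@iw (I x)) (S x) <= iB (I x))%R).
Proof.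
move=> HS; apply: polytime_ext (polytime_fle (p :=
  fun x => wfrac (@iw (I x)) (S x) _)
   (q := fun x => rfrac (iB (I x)))
     (polytime_wfrac polytime_weights HS) polytime_bound) => x.
rewrite fle_fval ?wfrac_gt0 ?rfrac_gt0 // fval_wfrac ?fval_rfrac //;
  first exact: iB_ge0.
exact: iw_ge0.
Qed.

Lemma polytime_weight_le (S T : forall x, {set iV (I x)}) :
  polytime f (fun x => enc_set (S x)) -> polytime f (fun x => enc_set (T x)) ->
  polytime f (fun x => enc_bool (weight (@iw (I x)) (S x) <=
    weight (@iw (I x)) (T x))%R).
Proof.
move=> HS HT; apply: polytime_ext (polytime_fle (p :=
  fun x => wfrac (@iw (I x)) (S x) _)
   (q := fun x => wfrac (@iw (I x)) (T x) _)
   (polytime_wfrac polytime_weights HS)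
     (polytime_wfrac polytime_weights HT)) => x.
by rewrite fle_fval ?wfrac_gt0 // !fval_wfrac //; apply: iw_ge0.
Qed.

Lemma polytime_lighter (S T : forall x, {set iV (I x)}) :
  polytime f (fun x => enc_set (S x)) -> polytime f (fun x => enc_set (T x)) ->
  polytime f (fun x => enc_set (lighter (@iw (I x)) (S x) (T x))).
Proof.
move=> HS HT.
apply: polytime_ext (polytime_if (polytime_weight_le HS HT) HS HT) => x.
by rewrite /lighter; case: ifP.
Qed.

Lemma polytime_light_set k :
  polytime f (fun x => enc_set (light_set (@iw (I x)) (iB (I x)) k)).
Proof.
apply: (polytime_map polytime_weights) => Y h t.
apply: (@polytime_ext _ _ (fun y => enc_bool (fle (k.+1 * (rfrac (iw
  (t y))).1, (rfrac (iw (t y))).2)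
     (rfrac (iB (I (h y))))))).
  move=> y; rewrite inE fle_fval ?rfrac_gt0 // fval_rfrac ?iB_ge0 //.
  by rewrite -[in RHS](fval_rfrac (iw_ge0 (t y))) /fval natrM -mulrA.
have Hw : polytime (fun y => Cons (f (h y)) (enc_rat (iw (t y))))
    (fun y => enc_frac (rfrac (iw (t y)))) by apply: polytime_snd.
apply: polytime_fle; last exact: (polytime_weak h _ polytime_bound).
apply: polytime_cons; last exact: (polytime_tl Hw).
by apply: polytime_mul; [apply: polytime_const | apply: (polytime_hd Hw)].
Qed.

Lemma pbound_enc_set : pbound (fsize f) (fun x => 4 * #|iV (I x)| + 1).
Proof.
apply: pbound_add; last exact: pbound_const.
by apply: pbound_mul; [apply: pbound_const | apply: pbound_card].
Qed.

End PolytimeAlgorithm.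

Lemma polytime_pass X (f : X -> tree) (I : X ->
  instance) (P S : forall x, {set iV (I x)}) :
  polytime f (fun x => enc_inst (I x)) ->
  polytime f (fun x => enc_set (P x)) -> polytime f (fun x => enc_set (S x)) ->
  polytime f (fun x => enc_set (pass (@iA (I x)) (@iw (I x)) (iB (I x)) (P x)
    (S x))).
Proof.
move=> fI HP HS.
apply: (polytime_foldl (eS := fun x => @enc_set (iV (I x)))
  (step := fun x => try_add (@iA (I x)) (@iw (I x)) (iB (I x)) (P x))
  (polytime_vertices fI) HS _ (pbound_enc_set fI)); last first.
  by move=> *; apply: size_enc_set_le.
move=> Y h s t; set ctx := (fun y : Y => _).
have Hs : polytime ctx (fun y => enc_set (s y)).
  exact: (polytime_comp (polytime_snd _ _) (polytime_fst _ _)).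
have Hv : polytime ctx (fun y => enc_set [set t y]).
  exact: (polytime_comp (polytime_snd _ _) (polytime_comp (polytime_snd _ _)
    (polytime_fst _ _))).
have Ho : polytime ctx (fun y => enc_set (out_nbrs (@iA (I (h y))) (t y))).
  exact: (polytime_comp (polytime_snd _ _) (polytime_comp (polytime_snd _ _)
    (polytime_snd _ _))).
have HI : polytime ctx (fun y => enc_inst (I (h y))) := polytime_weak h _ fI.
have HPy : polytime ctx (fun y => enc_set (P (h y))) := polytime_weak h _ HP.
have HU := polytime_setU Hv Hs.
apply: polytime_ext (polytime_if (polytime_and (polytime_subset Hv HPy)
  (polytime_and (polytime_subset Ho Hs)
    (polytime_weight_le_bound HI HU))) HU Hs) => y.
by rewrite /try_add sub1set; case: ifP.
Qed.

Lemma polytime_greedy X (f : X -> tree) (I : X ->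
  instance) (P S : forall x, {set iV (I x)}) :
  polytime f (fun x => enc_inst (I x)) ->
  polytime f (fun x => enc_set (P x)) -> polytime f (fun x => enc_set (S x)) ->
  polytime f (fun x => enc_set (greedy (@iA (I x)) (@iw (I x)) (iB (I x))
    (P x) (S x))).
Proof.
move=> fI HP HS.
apply: (polytime_foldl (eS := fun x => @enc_set (iV (I x)))
  (step := fun x T _ => pass (@iA (I x)) (@iw (I x)) (iB (I x)) (P x) T)
  (polytime_vertices fI) HS _ (pbound_enc_set fI)); last first.
  by move=> *; apply: size_enc_set_le.
move=> Y h s t; apply: polytime_pass.
- exact: (polytime_weak h _ fI).
- exact: (polytime_weak h _ HP).
- exact: (polytime_comp (polytime_snd _ _) (polytime_fst _ _)).
Qed.

Lemma polytime_candidate X (f : X -> tree) (I : X ->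
  instance) k (H : forall x, {set iV (I x)}) :
  polytime f (fun x => enc_inst (I x)) -> polytime f (fun x => enc_set (H x)) ->
  polytime f (fun x => enc_set (candidate (@iA (I x)) (@iw (I x)) (iB
    (I x)) k (H x))).
Proof.
move=> fI HH; have Hw := polytime_weights fI.
apply: polytime_greedy => //; first exact: polytime_setT Hw.
apply: polytime_greedy => //; last exact: polytime_set0 Hw.
by apply: polytime_setU => //; apply: polytime_light_set.
Qed.

(** Each level of [j] adds one nested loop over the vertices, and [j] is fixed before the input. The
    induction generalizes over the context because the inner search runs in a loop body. *)
Lemma polytime_search k j X (f : X -> tree) (I : X ->
  instance) (H best : forall x, {set iV (I x)}) :
  polytime f (fun x => enc_inst (I x)) ->
  polytime f (fun x => enc_set (H x)) ->
    polytime f (fun x => enc_set (best x)) ->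
  polytime f (fun x => enc_set (search (@iA (I x)) (@iw (I x)) (iB (I x)) k j
    (H x) (best x))).
Proof.
elim: j X f I H best => [|j IH] X f I H best fI HH Hb.
  by apply: polytime_lighter => //; apply: polytime_candidate.
apply: (polytime_foldl (eS := fun x => @enc_set (iV (I x)))
  (step := fun x b v => search (@iA (I x)) (@iw (I x)) (iB (I x)) k j
    (v |: H x) b)
  (polytime_vertices fI) (IH _ _ _ _ _ fI HH Hb) _ (pbound_enc_set fI));
    last first.
  by move=> *; apply: size_enc_set_le.
move=> Y h s t; apply: IH.
- exact: (polytime_weak h _ fI).
- apply: polytime_setU; last exact: (polytime_weak h _ HH).
  exact: (polytime_comp (polytime_snd _ _) (polytime_comp (polytime_snd _ _)
    (polytime_fst _ _))).
- exact: (polytime_comp (polytime_snd _ _) (polytime_fst _ _)).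
Qed.

Lemma polytime_ptas k :
  polytime enc_inst (fun I => enc_set (ptas (@iA I) (@iw I) (iB I) k)).
Proof.
have fI := polytime_id enc_inst.
have H0 : polytime enc_inst (fun I => enc_set (set0 : {set iV I})).
  exact: polytime_set0 (polytime_weights fI).
by apply: polytime_search => //; apply: polytime_candidate.
Qed.

Theorem theorem5 (k : nat) (hk : (1 <= k)%N) :
  exists (p : cmd) (c d : nat),
  forall (V : finType) (A : rel V) (w : V -> rat) (B : rat),
    dag A -> (forall v : V, (0 <= w v)%R) -> (0 < B)%R ->
    exists (t : nat) (S : {set V}) (opt : rat),
      [/\ runs p (enc_instance A w B) t (enc_set S),
          (t <= c * tree_size (enc_instance A w B) ^ d + c)%N,
          feasible A w B S,
          optimal_value A w B opt
        & (weight w S <= (k.+1)%:R / k%:R * opt)%R].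
Proof.
have [_ [p [m [T [[c [d bT]] H]]]]] := polytime_ptas k.
exists p, (c * 2 ^ d), d => V A w B dagA w0 B0.
pose I := Instance A w0 (ltW B0).
have [|t [s [es s0 _ tT]]] := H I (init (enc_inst I)); first by [].
have [opt Hopt] := exists_optimal dagA w0 B0.
exists t, (ptas A w B k), opt; split=> //.
- by exists s.
- apply: leq_trans tT (leq_trans (bT I) _).
  rewrite -mulnA -expnMn; apply: leq_trans (leq_addr _ _).
  rewrite leq_mul2l; apply/orP; right.
  have [->|d0] := posnP d; first by rewrite !expn0.
  rewrite leq_exp2r // /fsize -/(enc_inst I).
  by have := tree_size_gt0 (enc_inst I); rewrite {2}/enc_inst /=; lia.
- exact: ptas_feasible.
- exact: ptas_ratio.
Qed.
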